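(* Let $\mathcal N$ be a field of totally null 2-planes on $(\mathcal M,g)$, where $g$ is a 4-dimensional metric of any (including complex) signature. Assume that $\mathcal N$ is integrable, $[\mathcal N,\mathcal N]\subset\mathcal N$. Then there exists a unique connection $\check\nabla$ on $\mathcal N$, which encodes the conformal properties of this field of totally null 2-planes.
   Context: $g$ is a complex-valued metric on the 4-dimensional manifold $\mathcal M$ (a nondegenerate symmetric complex bilinear form on ${\rm T}^{\mathbb C}\mathcal M$; real metrics of any signature are included by complex bilinear extension). A field of totally null 2-planes is a complex rank-2 distribution $\mathcal N\subset{\rm T}^{\mathbb C}\mathcal M$ with $g_{|\mathcal N}\equiv0$. A connection on $\mathcal N$ here means a (in general complex) partial connection: it differentiates vector fields from $\mathcal N$ along vectors from $\mathcal N$, with values in $\mathcal N$. The connection $\check\nabla$ meant in the theorem, called the characteristic connection of $\mathcal N$, is by definition the restriction to $\mathcal N$ of a Weyl connection $\nabla^W$ that preserves $\mathcal N$, i.e. of a torsionless connection satisfying $\nabla^Wg=-Bg$ for some 1-form $B$ and $\nabla^W_YX\in\mathcal N$ for all $X\in\mathcal N$ and all $Y\in{\rm T}\mathcal M$. Such Weyl connections are not unique, since $B$ is only partially determined by $\mathcal N$; the uniqueness asserted is that of the restricted connection $\check\nabla$. The phrase ''encodes the conformal properties'' refers to the fact that the equation $\nabla^Wg=-Bg$ is preserved under $g\to{\rm e}^{2\phi}g$, $B\to B-2\,{\rm d}\phi$, so that $\check\nabla$ is constructed only from conformal objects. *)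

(* Defs.v *)
From HB Require Import structures.
From mathcomp Require Import all_boot all_order all_algebra.
From mathcomp Require Import complex.
From mathcomp Require Import boolp classical_sets reals.
From mathcomp Require Import topology normedtype sequences derive exp trigo.

Set Implicit Arguments.
Unset Strict Implicit.
Unset Printing Implicit Defensive.

Import Order.TTheory GRing.Theory Num.Theory.
Import numFieldNormedType.Exports.

Local Open Scope classical_set_scope.
Local Open Scope ring_scope.

(* Meant for an open [U], so that derivatives at points of [U] only depend
   on the restriction of [f] to [U]. *)
Fixpoint Ck (R : realType) (k : nat) (U : set 'rV[R]_4) (f : 'rV[R]_4 -> R)
    : Prop :=
  match k with
  | 0 => forall x, U x -> {for x, continuous f}
  | k'.+1 => (forall x, U x -> differentiable f x) /\
             (forall i : 'I_4, Ck k' U (fun x => 'D_(delta_mx 0 i) f x))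
  end.

Definition Cinfty (R : realType) (U : set 'rV[R]_4) (f : 'rV[R]_4 -> R) : Prop :=
  forall k, Ck k U f.

(* A smooth atlas (not required to be maximal).  [chart a] and [chartV a] are
   mutually inverse homeomorphisms between [chart_dom a] and [chart_cod a]; their
   values elsewhere are irrelevant.  [chart_at p] is an arbitrary (in general
   discontinuous) choice of a chart around [p], used to represent tangent
   vectors at [p]. *)
Record manifold4 (R : realType) (M : topologicalType) := Manifold4 {
  chart_index : Type;
  chart_dom : chart_index -> set M;
  chart_cod : chart_index -> set 'rV[R]_4;
  chart : chart_index -> M -> 'rV[R]_4;
  chartV : chart_index -> 'rV[R]_4 -> M;
  chart_at : M -> chart_index;
  manifold_hausdorff : hausdorff_space M;
  manifold_second_countable : @second_countable M;
  chart_dom_open : forall a, open (chart_dom a);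
  chart_cod_open : forall a, open (chart_cod a);
  chartP : forall a p, chart_dom a p -> chart_cod a (chart a p);
  chartVP : forall a x, chart_cod a x -> chart_dom a (chartV a x);
  chartK : forall a p, chart_dom a p -> chartV a (chart a p) = p;
  chartVK : forall a x, chart_cod a x -> chart a (chartV a x) = x;
  chart_continuous : forall a p, chart_dom a p -> {for p, continuous (chart a)};
  chartV_continuous : forall a x, chart_cod a x -> {for x, continuous (chartV a)};
  chart_atP : forall p, chart_dom (chart_at p) p;
  transition_smooth : forall (a b : chart_index) (j : 'I_4),
    Cinfty [set x | chart_cod a x /\ chart_dom b (chartV a x)]
           (fun x => chart b (chartV a x) 0 j)
}.

(* The fibre of the complexified tangent bundle at [p]: [v : cvec R] stands for
   the vector \sum_i v_i d/dx^i at [p], where the x^i are the coordinates of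
   the chart [chart_at p]. *)
Notation cvec R := 'rV[R[i]]_4.

Definition smooth_at (R : realType) (M : topologicalType) (A : manifold4 R M)
    (f : M -> R[i]) (p : M) : Prop :=
  let a := chart_at A p in
  exists V : set 'rV[R]_4,
    [/\ open V, V (chart a p), V `<=` chart_cod a,
        Cinfty V (fun x => complex.Re (f (chartV a x))) &
        Cinfty V (fun x => complex.Im (f (chartV a x)))].

Definition smooth (R : realType) (M : topologicalType) (A : manifold4 R M)
    (f : M -> R[i]) : Prop :=
  forall p, smooth_at A f p.

(* [partial A i f p] is df/dx^i at [p] in the coordinates of [chart_at p]. *)
Definition partial (R : realType) (M : topologicalType) (A : manifold4 R M)
    (i : 'I_4) (f : M -> R[i]) (p : M) : R[i] :=
  let a := chart_at A p in
  let e : 'rV[R]_4 := delta_mx 0 i in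
  Complex ('D_e (fun x => complex.Re (f (chartV a x))) (chart a p))
          ('D_e (fun x => complex.Im (f (chartV a x))) (chart a p)).

(* The derivative v(f) of [f] along the vector [v] at [p]. *)
Definition deriv_along (R : realType) (M : topologicalType) (A : manifold4 R M)
    (p : M) (v : cvec R) (f : M -> R[i]) : R[i] :=
  \sum_(i < 4) v 0 i * partial A i f p.

(* Jacobian matrix of the change of coordinates from [chart a] to [chart b] at
   [q], acting on row vectors of components. *)
Definition transition_jacobian (R : realType) (M : topologicalType)
    (A : manifold4 R M) (a b : chart_index A) (q : M) : 'M[R[i]]_4 :=
  map_mx (real_complex R)
    (jacobian (fun x : 'rV[R]_4 => chart b (chartV a x)) (chart a q)).

(* [component X a j q] is the j-th component at [q] of the vector field [X]
   in the coordinates of [chart a]; meaningful for [q] in [chart_dom a]. *)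
Definition component (R : realType) (M : topologicalType) (A : manifold4 R M)
    (X : M -> cvec R) (a : chart_index A) (j : 'I_4) (q : M) : R[i] :=
  (X q *m transition_jacobian (chart_at A q) a q) 0 j.

Definition smooth_field_at (R : realType) (M : topologicalType)
    (A : manifold4 R M) (X : M -> cvec R) (p : M) : Prop :=
  forall j : 'I_4, smooth_at A (component X (chart_at A p) j) p.

(* [X, Y]^j = X(Y^j) - Y(X^j), in the coordinates of [chart_at p]. *)
Definition lie_bracket (R : realType) (M : topologicalType) (A : manifold4 R M)
    (X Y : M -> cvec R) (p : M) : cvec R :=
  \row_(j < 4) (deriv_along A p (X p) (component Y (chart_at A p) j)
                - deriv_along A p (Y p) (component X (chart_at A p) j)).

(* [g p] is the Gram matrix of a bilinear form on the fibre at [p]. *)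
Definition pairing (R : realType) (M : Type) (g : M -> 'M[R[i]]_4)
    (p : M) (u v : cvec R) : R[i] :=
  (u *m g p *m v^T) 0 0.

Definition is_metric (R : realType) (M : topologicalType) (A : manifold4 R M)
    (g : M -> 'M[R[i]]_4) : Prop :=
  [/\ forall p u v, pairing g p u v = pairing g p v u,
      forall p u, (forall v, pairing g p u v = 0) -> u = 0 &
      forall p X Y, smooth_field_at A X p -> smooth_field_at A Y p ->
        smooth_at A (fun q => pairing g q (X q) (Y q)) p].

Definition form_eval (R : realType) (M : Type) (B : M -> 'cV[R[i]]_4)
    (p : M) (v : cvec R) : R[i] :=
  (v *m B p) 0 0.

Definition is_oneform (R : realType) (M : topologicalType) (A : manifold4 R M)
    (B : M -> 'cV[R[i]]_4) : Prop :=
  forall p X, smooth_field_at A X p ->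
    smooth_at A (fun q => form_eval B q (X q)) p.

Definition differential (R : realType) (M : topologicalType)
    (A : manifold4 R M) (f : M -> R[i]) (p : M) : 'cV[R[i]]_4 :=
  \col_(i < 4) partial A i f p.

Definition is_distribution2 (R : realType) (M : topologicalType)
    (A : manifold4 R M) (N : M -> {vspace cvec R}) : Prop :=
  forall p, exists X1 X2 : M -> cvec R,
    [/\ smooth_field_at A X1 p, smooth_field_at A X2 p &
        \forall q \near p, \dim (N q) = 2%N /\ N q = <<[:: X1 q; X2 q]>>%VS].

Definition totally_null (R : realType) (M : Type) (g : M -> 'M[R[i]]_4)
    (N : M -> {vspace cvec R}) : Prop :=
  forall p u v, u \in N p -> v \in N p -> pairing g p u v = 0.

(* Germs at [p] of smooth sections of the distribution [N]. *)
Definition section_at (R : realType) (M : topologicalType) (A : manifold4 R M)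
    (N : M -> {vspace cvec R}) (X : M -> cvec R) (p : M) : Prop :=
  smooth_field_at A X p /\ \forall q \near p, X q \in N q.

Definition integrable (R : realType) (M : topologicalType) (A : manifold4 R M)
    (N : M -> {vspace cvec R}) : Prop :=
  forall p X Y, section_at A N X p -> section_at A N Y p ->
    lie_bracket A X Y p \in N p.

(* [nabla Y p v] is the derivative of [Y] along the vector [v] at [p]. *)
Definition covariant_derivative (R : realType) (M : Type) :=
  (M -> cvec R) -> M -> cvec R -> cvec R.

(* [nabla Y p v] is only constrained for [v] in [N p] and [Y] a smooth section
   of [N] near [p], so equality of connections on [N] is [eq_on] below.  The
   Leibniz rule, applied to the indicator of an open neighbourhood of [p], makes
   [nabla Y p v] depend only on the germ of [Y] at [p].  For [N := fun=> fullv]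
   this is a linear connection on the complexified tangent bundle. *)
Definition is_connection_on (R : realType) (M : topologicalType)
    (A : manifold4 R M) (N : M -> {vspace cvec R})
    (nabla : covariant_derivative R M) : Prop :=
  [/\ forall p Y v, section_at A N Y p -> v \in N p -> nabla Y p v \in N p,
      forall p Y (c : R[i]) u v, section_at A N Y p -> u \in N p -> v \in N p ->
        nabla Y p (c *: u + v) = c *: nabla Y p u + nabla Y p v,
      forall p Y Z v, section_at A N Y p -> section_at A N Z p -> v \in N p ->
        nabla (fun q => Y q + Z q) p v = nabla Y p v + nabla Z p v,
      forall p f Y v, smooth_at A f p -> section_at A N Y p -> v \in N p ->
        nabla (fun q => f q *: Y q) p v
          = deriv_along A p v f *: Y p + f p *: nabla Y p v &
      forall p X Y, section_at A N X p -> section_at A N Y p ->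
        smooth_field_at A (fun q => nabla Y q (X q)) p].

Definition is_linear_connection (R : realType) (M : topologicalType)
    (A : manifold4 R M) (nabla : covariant_derivative R M) : Prop :=
  is_connection_on A (fun=> fullv) nabla.

Definition torsionless (R : realType) (M : topologicalType)
    (A : manifold4 R M) (nabla : covariant_derivative R M) : Prop :=
  forall p X Y, smooth_field_at A X p -> smooth_field_at A Y p ->
    nabla Y p (X p) - nabla X p (Y p) = lie_bracket A X Y p.

(* (nabla_v g)(X, Y) *)
Definition covd_metric (R : realType) (M : topologicalType)
    (A : manifold4 R M) (nabla : covariant_derivative R M)
    (g : M -> 'M[R[i]]_4) (p : M) (v : cvec R) (X Y : M -> cvec R) : R[i] :=
  deriv_along A p v (fun q => pairing g q (X q) (Y q))
  - pairing g p (nabla X p v) (Y p) - pairing g p (X p) (nabla Y p v).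

Definition is_weyl (R : realType) (M : topologicalType) (A : manifold4 R M)
    (g : M -> 'M[R[i]]_4) (nabla : covariant_derivative R M)
    (B : M -> 'cV[R[i]]_4) : Prop :=
  [/\ is_linear_connection A nabla, torsionless A nabla, is_oneform A B &
      forall p v X Y, smooth_field_at A X p -> smooth_field_at A Y p ->
        covd_metric A nabla g p v X Y
          = - form_eval B p v * pairing g p (X p) (Y p)].

Definition preserves (R : realType) (M : topologicalType) (A : manifold4 R M)
    (N : M -> {vspace cvec R}) (nabla : covariant_derivative R M) : Prop :=
  forall p X v, section_at A N X p -> nabla X p v \in N p.

Definition eq_on (R : realType) (M : topologicalType) (A : manifold4 R M)
    (N : M -> {vspace cvec R}) (nabla nabla' : covariant_derivative R M) : Prop :=
  forall p Y v, section_at A N Y p -> v \in N p -> nabla Y p v = nabla' Y p v.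

Definition is_characteristic (R : realType) (M : topologicalType)
    (A : manifold4 R M) (g : M -> 'M[R[i]]_4) (N : M -> {vspace cvec R})
    (nablaN : covariant_derivative R M) : Prop :=
  is_connection_on A N nablaN /\
  exists (nablaW : covariant_derivative R M) (B : M -> 'cV[R[i]]_4),
    [/\ is_weyl A g nablaW B, preserves A N nablaW & eq_on A N nablaN nablaW].

Definition cexp (R : realType) (z : R[i]) : R[i] :=
  Complex (expR (complex.Re z) * cos (complex.Im z))
          (expR (complex.Re z) * sin (complex.Im z)).

Definition rescale (R : realType) (M : Type) (phi : M -> R[i])
    (g : M -> 'M[R[i]]_4) : M -> 'M[R[i]]_4 :=
  fun p => cexp (2 * phi p) *: g p.

(* Main.v *)
(** A torsion-free connection with [nabla g = - B g] is given by the Koszul formula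
    [2 g(nabla_X Y, Z) = K_B(X, Y, Z)].  As [N] is totally null of half the
    dimension, it equals its own orthogonal, so [nabla] preserves [N] iff
    [K_B(X, Y, Z) = 0] for all sections [Y], [Z] of [N].  This expression is
    tensorial, skew in [Y] and [Z], and, by integrability, vanishes for [X] in [N].
    In a local frame it thus prescribes [B] on [N] and nothing else: such [B] exist
    locally, hence globally by a partition of unity, and the restriction of
    [nabla] to [N] only depends on the restriction of [B] to [N]. *)

Require Import Defs.
From HB Require Import structures.
From mathcomp Require Import all_boot all_order all_algebra.
From mathcomp Require Import complex ring lra.
From mathcomp Require Import boolp classical_sets functions cardinality reals.
From mathcomp Require Import topology normedtype sequences derive realfun exp trigo landau.

Set Implicit Arguments.
Unset Strict Implicit.
Unset Printing Implicit Defensive.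

Import Order.TTheory GRing.Theory Num.Theory.
Import numFieldNormedType.Exports.

Local Open Scope classical_set_scope.
Local Open Scope ring_scope.

(** * Smooth functions on R^4 *)

(** For [Y], [Z] in N the 1-form enters [K_B(X, Y, Z)] only through [B(Y) g(X, Z) - B(Z) g(X, Y)].
    For a frame [X1], [X2] of N the rest of [K_B(X, X1, X2)] is a covector in [X] that kills N; as N
    is its own orthogonal, g turns it into a vector of N, whose two coordinates in the frame are, up
    to sign and order, the values forced on [B(X1)] and [B(X2)]. Conversely, for [X], [Y] in N and
    any [Z], the value [B(Z)] is multiplied by [g(X, Y) = 0], so the restricted connection does not
    see [B] off N. Two features of the encoding shape the proof. Components at a point refer to the
    chart [chart_at], which may jump from point to point, so everything is moved to one fixed chart
    before it is differentiated, and g is smooth only through its pairings with smooth fields.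
    Moreover a connection differentiates along a vector, whereas the Koszul expression takes fields;
    its tensoriality in [X] and [Z] turns it into a matrix at each point. *)

Lemma near_eq_differentiable (R : numFieldType) (V W : normedModType R)
    (f g : V -> W) (x : V) :
  (\near x, f x = g x) -> differentiable f x -> differentiable g x.
Proof.
move=> fg df; have fgx : f x = g x := nbhs_singleton fg.
have [dc fE] := (diff_locallyP _ _).1 df.
(* The expansion of [g] is proved with the differential of [f]; [diff_unique] then identifies it
   with that of [g]. *)
have gE : g \o shift x = cst (g x) + 'd f x +o_ 0 id.
  apply/eqaddoP => e e0.
  have := (eqaddoP _ _ _ _).1 fE e e0.
  have : \forall y \near (0 : V), f (y + x) = g (y + x).
    by move: fg; rewrite (near_shift 0)/= subr0.
  apply: filterS2 => y /= fgy; apply: le_trans; rewrite le_eqVlt.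
  by apply/orP; left; rewrite !fctE/= -fgy fgx.
by apply/diff_locallyP; rewrite (diff_unique dc gE).
Qed.

Section Ck.
Variable R : realType.
Notation E := 'rV[R]_4.
Notation e_ i := (delta_mx 0 i : E).
Implicit Types (U V : set E) (f g : E -> R) (k : nat).

Lemma Ck_sub k U V f : U `<=` V -> Ck k V f -> Ck k U f.
Proof.
elim: k f => [|k IH] f UV /=; first by move=> c x /UV /c.
by move=> [d D]; split=> [x /UV /d //|i]; apply: IH.
Qed.

Lemma CkS k U f : Ck k.+1 U f -> Ck k U f.
Proof.
elim: k f => [|k IH] f /= [d D].
  by move=> x Ux; apply: differentiable_continuous; apply: d.
by split=> // i; apply: IH; apply: D.
Qed.

Lemma eq_Ck k U f g : open U -> {in U, f =1 g} -> Ck k U f -> Ck k U g.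
Proof.
move=> oU; elim: k f g => [|k IH] f g fg /=.
  move=> cf x Ux; have nfg : \near x, f x = g x.
    near=> y; apply: fg; rewrite inE; near: y; exact: open_nbhs_nbhs.
  rewrite /prop_for /continuous_at -(fg x) ?inE//.
  exact: cvg_trans (near_eq_cvg nfg) (cf x Ux).
move=> [df Df]; split=> [x Ux|i].
  apply: near_eq_differentiable (df x Ux).
  near=> y; apply: fg; rewrite inE; near: y; exact: open_nbhs_nbhs.
apply: (IH _ _ _ (Df i)) => x; rewrite inE => Ux; apply: near_eq_derive.
near=> y; apply: fg; rewrite inE; near: y; exact: open_nbhs_nbhs.
Unshelve. all: by end_near. Qed.

Lemma Ck_cst k U (c : R) : Ck k U (cst c).
Proof.
elim: k c => [|k IH] c /=; first by move=> x _; exact: cst_continuous.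
split=> [x _|i]; first exact: differentiable_cst.
rewrite (_ : (fun _ => _) = cst 0) //.
by apply/funext => x; rewrite derive_cst.
Qed.

Lemma CkD k U f g : open U -> Ck k U f -> Ck k U g -> Ck k U (f + g).
Proof.
move=> oU; elim: k f g => [|k IH] f g /=.
  by move=> cf cg x Ux; apply: continuousD; [exact: cf|exact: cg].
move=> [df Df] [dg Dg]; split=> [x Ux|i].
  by apply: differentiableD; [exact: df|exact: dg].
apply: (eq_Ck oU _ (IH _ _ (Df i) (Dg i))) => x; rewrite inE => Ux.
by rewrite deriveD//; apply: diff_derivable; [exact: df|exact: dg].
Qed.

Lemma CkM k U f g : open U -> Ck k U f -> Ck k U g -> Ck k U (f * g).
Proof.
move=> oU; elim: k f g => [|k IH] f g.
  by move=> cf cg x Ux; apply: continuousM; [exact: cf|exact: cg].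
move=> cf cg; have [[df Df] [dg Dg]] := (cf, cg).
split=> [x Ux|i]; first by apply: differentiableM; [exact: df|exact: dg].
have := CkD oU (IH _ _ (CkS cf) (Dg i)) (IH _ _ (CkS cg) (Df i)).
apply: eq_Ck => // x; rewrite inE => Ux.
by rewrite [RHS]deriveM//; apply: diff_derivable; [exact: df|exact: dg].
Qed.

Lemma Ck_sum k U n (f : 'I_n -> E -> R) : open U ->
  (forall i, Ck k U (f i)) -> Ck k U (fun x => \sum_(i < n) f i x).
Proof.
move=> oU; elim: n f => [|n IH] f cf.
  by apply: (eq_Ck oU _ (Ck_cst k U 0)) => x _; rewrite big_ord0.
have := CkD oU (IH _ (fun i => cf (widen_ord (leqnSn n) i))) (cf ord_max).
by apply: eq_Ck => // x _; rewrite big_ord_recr.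
Qed.

Lemma CkN k U f : open U -> Ck k U f -> Ck k U (- f).
Proof.
move=> oU cf; apply: (eq_Ck oU _ (CkM oU (Ck_cst k U (-1)) cf)) => x _.
by rewrite /= mulN1r.
Qed.

(** The derivative of [1 / f] is [- (1 / f)^2] times that of [f], so the induction hypothesis,
    applied to [1 / f] itself, closes the step. *)
Lemma CkV k U f : open U -> (forall x, U x -> f x != 0) -> Ck k U f ->
  Ck k U (fun x => (f x)^-1).
Proof.
move=> oU f0; elim: k => [|k IH].
  by move=> cf x Ux; apply: continuousV; [exact: (f0 x Ux)|exact: cf].
move=> cf; have [df Df] := cf; split=> [x Ux|i].
  by apply: differentiableV; [exact: df|exact: f0].
have cV := IH (CkS cf).
have := CkN oU (CkM oU (CkM oU cV cV) (Df i)).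
apply: eq_Ck => // x; rewrite inE => Ux.
rewrite deriveV ?f0//; last exact/diff_derivable/df.
by rewrite -[LHS]/(- ((f x)^-1 * (f x)^-1 * _)) -exprVn expr2 -scaleNr.
Qed.

Definition Ckmap k U (t : E -> E) := forall j, Ck k U (fun x => t x 0 j).

Lemma row_deltaE (t : E -> E) : t = \sum_(j < 4) (fun x => t x 0 j *: e_ j).
Proof. by apply/funext => x; rewrite fct_sumE [LHS]row_sum_delta. Qed.

Lemma differentiable_row (t : E -> E) x :
  (forall j, differentiable (fun x => t x 0 j) x) -> differentiable t x.
Proof.
move=> dt; rewrite (row_deltaE t); apply: differentiable_sum => j.
exact: differentiableZl.
Qed.

Lemma derive_row (t : E -> E) x v j : differentiable t x ->
  ('D_v t x) 0 j = 'D_v (fun x => t x 0 j) x.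
Proof. by move=> dt; rewrite derive_mx ?mxE//; apply: diff_derivable. Qed.

Lemma derive_delta_sum f x v : differentiable f x ->
  'D_v f x = \sum_(j < 4) v 0 j * 'D_(e_ j) f x.
Proof.
move=> df; rewrite deriveE// [v in LHS]row_sum_delta linear_sum.
by apply: eq_bigr => j _; rewrite linearZ /= deriveE.
Qed.

Lemma derive_comp_row f (t : E -> E) x v :
  differentiable t x -> differentiable f (t x) ->
  'D_v (f \o t) x = \sum_(j < 4) 'D_v (fun x => t x 0 j) x * 'D_(e_ j) f (t x).
Proof.
move=> dt df; rewrite deriveE; last exact: differentiable_comp.
rewrite diff_comp//= -(deriveE _ df) derive_delta_sum//.
by apply: eq_bigr => j _; rewrite -deriveE// derive_row.
Qed.

Lemma Ckmap_differentiable k U t x : Ckmap k.+1 U t -> U x -> differentiable t x.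
Proof.
by move=> ct Ux; apply: differentiable_row => j; apply: (ct j).1.
Qed.

(** By the chain rule the partial derivatives of [f \o t] are sums of products of a derivative of
    [t] with some ['D_(e_ j) f \o t], to which the induction applies. The base case uses continuity
    of [t] as a map, not of its entries. *)
Lemma Ck_comp k U V f t : open U -> (forall x, U x -> V (t x)) ->
  (forall x, U x -> {for x, continuous t}) ->
  Ck k V f -> Ckmap k U t -> Ck k U (f \o t).
Proof.
move=> oU tUV tc; elim: k f => [|k IH] f cf ct.
  by move=> x Ux; apply: continuous_comp; [exact: tc|exact/cf/tUV].
have [df Df] := cf; split=> [x Ux|i].
  apply: differentiable_comp; first exact: Ckmap_differentiable ct Ux.
  exact/df/tUV.
have ct' : Ckmap k U t by move=> j; exact/CkS/ct.
have H j : Ck k U ('D_(e_ i) (fun x => t x 0 j) * ('D_(e_ j) f \o t)).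
  by apply: CkM => //; [exact: (ct j).2|exact: IH (Df j) ct'].
apply: (eq_Ck oU _ (Ck_sum oU H)) => x; rewrite inE => Ux.
rewrite [RHS]derive_comp_row//; last exact/df/tUV.
exact: Ckmap_differentiable ct Ux.
Qed.

Lemma Ck_coord k U j : Ck k U (fun x => x 0 j).
Proof.
case: k => [|k]; first by move=> x _; exact: coord_continuous.
split=> [x _|i]; first exact: differentiable_coord.
rewrite (_ : (fun _ => _) = cst ((e_ i) 0 j)); first exact: Ck_cst.
by apply/funext => x; rewrite -(@derive_row id)// derive_id.
Qed.

End Ck.

(** * Symmetry of second partial derivatives *)

Section Schwarz.
Variable R : realType.
Notation E := 'rV[R]_4.
Notation e_ i := (delta_mx 0 i : E).
Implicit Types (f : E -> R) (U W : set E).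

Lemma is_derive_line f (v y : E) (s : R) : differentiable f (s *: v + y) ->
  is_derive s 1 (fun s : R => f (s *: v + y)) ('D_v f (s *: v + y)).
Proof.
move=> df; have dl : differentiable (fun s : R => s *: v + y) s by [].
apply: DeriveDef; first exact/derivable1_diffP/differentiable_comp.
rewrite deriveE; last exact: differentiable_comp.
rewrite diff_comp// deriveE//=; congr ('d f _ _).
by rewrite diff_val /= addr0 scale1r.
Qed.

(** The mean value theorem is applied twice, first along [e_ i], then along [e_ j]. The left-hand
    side is symmetric in [i] and [j], while the derivative on the right is not; this is what yields
    Schwarz's theorem. *)
Lemma second_difference f U x i j : open U -> U x -> Ck 2 U f ->
  exists2 d : R, 0 < d & forall h : R, 0 < h < d -> exists2 y, U y &
    f (h *: e_ i + (h *: e_ j + x)) - f (h *: e_ i + x)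
      - f (h *: e_ j + x) + f x = h * h * 'D_(e_ j) ('D_(e_ i) f) y.
Proof.
move=> oU Ux [df /(_ i)[dDf _]].
have /nbhs_ballP[r /= r0 rU] := open_nbhs_nbhs (conj oU Ux).
(* The summand 1 makes [c] positive and the distance estimate strict: for [h < r / c] the whole
   parallelogram of side [h] lies in the open ball of radius [r]. *)
set c : R := `|e_ i| + `|e_ j| + 1.
have c0 : 0 < c by rewrite ltr_wpDl ?addr_ge0.
exists (r / c); first by rewrite divr_gt0.
move=> h /andP[h0 hrc].
have inU (s t : R) : 0 <= s <= h -> 0 <= t <= h -> U (s *: e_ i + (t *: e_ j + x)).
  move=> /andP[s0 sh] /andP[t0 th]; apply: rU; rewrite -ball_normE /=.
  rewrite addrA opprD addrCA subrr addr0 normrN.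
  apply: le_lt_trans (ler_normD _ _) _; rewrite !normrZ !ger0_norm//.
  apply: (@le_lt_trans _ _ (h * (`|e_ i| + `|e_ j|))).
    by rewrite mulrDr lerD// ler_wpM2r.
  apply: lt_le_trans (_ : h * c <= _); first by rewrite ltr_pM2l// ltrDl.
  by rewrite -ler_pdivlMr// ltW.
have inU0 (s : R) : 0 <= s <= h -> U (s *: e_ i + x).
  by move=> sh; have := inU s 0 sh; rewrite lexx ltW// scale0r add0r; apply.
(* The increment of [f] along [h *: e_ j], as a function of the displacement along [e_ i];
   [p h - p 0] is the second difference. *)
pose p (s : R) := f (s *: e_ i + (h *: e_ j + x)) - f (s *: e_ i + x).
pose dp (s : R) := 'D_(e_ i) f (s *: e_ i + (h *: e_ j + x))
                   - 'D_(e_ i) f (s *: e_ i + x).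
have hh : 0 <= h <= h by rewrite lexx ltW.
have pd s : 0 <= s <= h -> is_derive s 1 p (dp s).
  move=> sh; apply: is_deriveB; apply: is_derive_line; apply: df.
    exact: inU.
  exact: inU0.
have [s sI] : exists2 s, s \in `]0, h[%R & p h - p 0 = dp s * (h - 0).
  apply: MVT; first exact: h0.
    by move=> s; rewrite in_itv/= => /andP[s0 sh]; apply: pd; rewrite !ltW.
  apply: derivable_within_continuous => s; rewrite in_itv/= => sh.
  by case: (pd s sh).
have {sI} sh : 0 <= s <= h.
  by move: sI; rewrite in_itv/= => /andP[? ?]; rewrite !ltW.
rewrite subr0 /p !scale0r !add0r => pE.
pose q (t : R) := 'D_(e_ i) f (t *: e_ j + (s *: e_ i + x)).
pose dq (t : R) := 'D_(e_ j) ('D_(e_ i) f) (t *: e_ j + (s *: e_ i + x)).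
have inU' (t : R) : 0 <= t <= h -> U (t *: e_ j + (s *: e_ i + x)).
  by move=> th; rewrite addrCA; exact: inU.
have qd t : 0 <= t <= h -> is_derive t 1 q (dq t).
  by move=> th; apply: is_derive_line; apply/dDf/inU'.
have [t tI] : exists2 t, t \in `]0, h[%R & q h - q 0 = dq t * (h - 0).
  apply: MVT; first exact: h0.
    by move=> t; rewrite in_itv/= => /andP[t0 th]; apply: qd; rewrite !ltW.
  apply: derivable_within_continuous => t; rewrite in_itv/= => th.
  by case: (qd t th).
rewrite subr0 /q scale0r add0r => qE.
exists (t *: e_ j + (s *: e_ i + x)).
  by apply: inU'; move: tI; rewrite in_itv/= => /andP[? ?]; rewrite !ltW.
have dpE : dp s = dq t * h.
  by rewrite -qE /dp [s *: e_ i + (_ + x)]addrCA.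
rewrite -/(dq t) -mulrA [h * dq t]mulrC -dpE [h * _]mulrC -pE.
by rewrite [- (_ - f x)]opprD opprK [RHS]addrA.
Qed.

(** For small [h] the same second difference is computed in both orders, so [F y = G z] for some
    [y], [z] near [x]; by continuity [F x] and [G x] are then within any [e] of each other. *)
Lemma schwarz f U x i j : open U -> U x -> Ck 2 U f ->
  'D_(e_ j) ('D_(e_ i) f) x = 'D_(e_ i) ('D_(e_ j) f) x.
Proof.
move=> oU Ux cf; apply/eqP; rewrite -subr_eq0 -normr_le0.
apply/ler_addgt0Pr => e e0; rewrite add0r.
have e2 : 0 < e / 2 by rewrite divr_gt0.
set F := 'D_(e_ j) ('D_(e_ i) f); set G := 'D_(e_ i) ('D_(e_ j) f).
have cF : {for x, continuous F} by case: cf => _ /(_ i)[_ /(_ j)]; apply.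
have cG : {for x, continuous G} by case: cf => _ /(_ j)[_ /(_ i)]; apply.
have : \forall y \near x, U y /\ `|F x - F y| < e / 2 /\ `|G x - G y| < e / 2.
  have nF : \forall y \near x, `|F x - F y| < e / 2.
    by move/cvgrPdist_lt : cF => /(_ _ e2).
  have nG : \forall y \near x, `|G x - G y| < e / 2.
    by move/cvgrPdist_lt : cG => /(_ _ e2).
  have nU : \forall y \near x, U y by exact: open_nbhs_nbhs.
  by apply: filterS3 nU nF nG.
rewrite -nbhs_nearE nbhsE /= => -[W [oW Wx] WP].
have WU : W `<=` U by move=> y /WP[].
have [d1 d10 H1] := second_difference i j oW Wx (Ck_sub WU cf).
have [d2 d20 H2] := second_difference j i oW Wx (Ck_sub WU cf).
pose h := Num.min d1 d2 / 2.
have m0 : 0 < Num.min d1 d2 by rewrite lt_min d10.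
have h0 : 0 < h by rewrite divr_gt0.
have hm : h < Num.min d1 d2 by rewrite ltr_pdivrMr// ltr_pMr// ltr1n.
have [|y Wy yE] := H1 h; first by rewrite h0 (lt_le_trans hm)// ge_min lexx.
have [|z Wz zE] := H2 h; first by rewrite h0 (lt_le_trans hm)// ge_min lexx orbT.
have FG : F y = G z.
  apply: (mulfI (mulf_neq0 (lt0r_neq0 h0) (lt0r_neq0 h0))).
  apply: etrans (esym yE) _; apply: etrans _ zE.
  congr (_ + _); rewrite [RHS]addrAC.
  by congr (f _ - _ - _); exact: addrCA.
have [_ [Fy _]] := WP _ Wy; have [_ [_ Gz]] := WP _ Wz.
have subDK (a b c : R) : a - b = (a - c) - (b - c) by ring.
rewrite (subDK _ _ (F y)) [in X in _ - X]FG.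
apply: le_trans (ler_normB _ _) _; rewrite [leRHS]splitr.
by apply: lerD; apply: ltW; [exact: Fy|exact: Gz].
Unshelve. all: by end_near. Qed.

End Schwarz.

(** * Smooth bump functions with compact support *)

Section bump.
Variable R : realType.
Notation E := 'rV[R]_4.
Notation e_ i := (delta_mx 0 i : E).

(** The classical flat function [exp (-1/t)]. The powers of [t^-1] are included because the linear
    span of the family is then closed under differentiation, so smoothness follows by an induction
    on the order for all [n] at once. *)
Definition flat_exp (n : nat) (t : R) : R :=
  if 0 < t then t^-1 ^+ n * expR (- t^-1) else 0.

(** The exponential series gives [exp (1/t) >= t^-(n+1) / (n+1)!] for [t > 0]. The bound is used at
    index [n+1], to control the difference quotient of [flat_exp n] at 0. *)
Lemma flat_exp_le n t : `|flat_exp n t| <= (n.+1)`!%:R * `|t|.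
Proof.
rewrite /flat_exp; case: ifPn => [t0|_]; last by rewrite normr0 mulr_ge0.
have tV : 0 <= t^-1 by rewrite invr_ge0 ltW.
have H := expR_ge1Dxn n tV.
rewrite ger0_norm ?mulr_ge0 ?exprn_ge0 ?expR_ge0// gtr0_norm//.
rewrite expRN ler_pdivrMr ?expR_gt0//.
have f0 : 0 < (n.+1)`!%:R :> R by rewrite ltr0n fact_gt0.
have : t^-1 ^+ n.+1 / (n.+1)`!%:R <= expR t^-1 by apply: le_trans H; rewrite lerDr.
rewrite ler_pdivrMr// exprS mulrC -ler_pdivlMr ?invr_gt0// invrK => /le_trans.
by apply; rewrite le_eqVlt; apply/orP; left; apply/eqP; ring.
Qed.

Lemma is_derive_flat_exp n (t : R) :
  is_derive t 1 (flat_exp n) (- n%:R * flat_exp n.+1 t + flat_exp n.+2 t).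
Proof.
have [t0|t0|->] := ltgtP t 0.
- rewrite /flat_exp ltNge ltW//= mulr0 addr0.
  apply: near_eq_is_derive (is_derive_cst 0 t 1).
  near=> s; rewrite /flat_exp ltNge ltW//; near: s; exact: lt_nbhsl.
- apply: (@near_eq_is_derive _ _ _ (fun s : R => s^-1 ^+ n * expR (- s^-1))).
    near=> s; rewrite /flat_exp ifT//; near: s; exact: lt_nbhsr.
  have dV : is_derive t 1 (fun s : R => s^-1) (- t^-1 ^+ 2).
    apply: DeriveDef; first by apply: derivableV; rewrite ?lt0r_neq0.
    rewrite (@deriveV _ _ id) ?lt0r_neq0// derive_id.
    by rewrite [_ *: _]mulr1 exprVn.
  have dE : is_derive t 1 (fun s : R => expR (- s^-1)) (t^-1 ^+ 2 * expR (- t^-1)).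
    apply: is_derive_eq (is_derive1_comp (is_derive_expR _) (is_deriveN dV)) _.
    by rewrite opprK mulrC.
  have dX : is_derive t 1 (fun s : R => s^-1 ^+ n) (- n%:R * t^-1 ^+ n.+1).
    case: n {dE} => [|n]; first by rewrite oppr0 mul0r; exact: is_derive_cst.
    rewrite (_ : (fun _ => _) = (fun s : R => s^-1) ^+ n.+1); last first.
      by apply/funext => s; rewrite exprfctE.
    apply: is_derive_eq (is_deriveX n.+1 dV) _.
    rewrite [LHS](_ : _ = n.+1%:R * t^-1 ^+ n * - t^-1 ^+ 2)//.
    by rewrite mulrN mulNr -mulrA -exprD addn2.
  apply: is_derive_eq (is_deriveM dX dE) _.
  set u := t^-1 in dE dX *.
  rewrite [LHS](_ : _ = u ^+ n * (u ^+ 2 * expR (- u))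
    + expR (- u) * (- n%:R * u ^+ n.+1))//.
  by rewrite /flat_exp t0 mulrA -exprD addn2 addrC mulrC mulrA.
(* At the origin the difference quotient is exactly [flat_exp n.+1 h], hence is [O(h)] and the
   derivative is 0. *)
- have cv : h^-1 *: (flat_exp n (h *: 1 + 0) - flat_exp n 0) @[h --> 0^'] --> (0 : R).
    apply/cvgrPdist_le => e e0.
    have f0 : 0 < (n.+2)`!%:R :> R by rewrite ltr0n fact_gt0.
    near=> h; rewrite sub0r normrN.
    have -> : h^-1 *: (flat_exp n (h *: 1 + 0) - flat_exp n 0) = flat_exp n.+1 h.
      rewrite addr0 [h *: 1]mulr1 /flat_exp ltxx subr0.
      by case: ifP => _; [rewrite exprS -mulrA|exact: mulr0].
    apply: le_trans (flat_exp_le _ _) _; rewrite -ler_pdivlMl//.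
    by near: h; apply: dnbhs0_le; rewrite mulr_gt0// invr_gt0.
  rewrite [flat_exp n.+1 0]/flat_exp [flat_exp n.+2 0]/flat_exp ltxx mulr0 addr0.
  by apply: DeriveDef; [apply/cvg_ex; exists 0|exact: cvg_lim].
Unshelve. all: by end_near. Qed.


Lemma derive_comp_real (h : R -> R) (u : E -> R) (x v : E) :
  derivable h (u x) 1 -> differentiable u x ->
  'D_v (h \o u) x = 'D_1 h (u x) * 'D_v u x.
Proof.
move=> /derivable1_diffP dh du.
rewrite deriveE; last exact: differentiable_comp.
rewrite diff_comp//= -(deriveE _ du) diff1E// derive1E.
exact: mulrC.
Qed.

Lemma Ck_flat_exp k n (U : set E) (u : E -> R) : open U -> Ck k U u ->
  Ck k U (flat_exp n \o u).
Proof.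
move=> oU; elim: k n => [|k IH] n.
  move=> cu x Ux; apply: continuous_comp; first exact: cu.
  apply: differentiable_continuous; apply/derivable1_diffP.
  by case: (is_derive_flat_exp n (u x)).
move=> cu; have [du Du] := cu; have cu' := CkS cu.
have dh x : derivable (flat_exp n) (u x) 1.
  by case: (is_derive_flat_exp n (u x)).
split=> [x Ux|i].
  by apply: differentiable_comp; [exact: du|exact/derivable1_diffP].
have := CkM oU (CkD oU (CkM oU (Ck_cst k U (- n%:R)) (IH n.+1 cu')) (IH n.+2 cu')) (Du i).
apply: eq_Ck => // x; rewrite inE => Ux.
rewrite derive_comp_real//; last exact: du.
by case: (is_derive_flat_exp n (u x)) => _ ->.
Qed.

(** A smooth transition from 0 on [t <= 0] to 1 on [t >= 1]; the denominator is positive since [t]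
    and [1 - t] are never both nonpositive. *)
Definition step (t : R) := flat_exp 0 t / (flat_exp 0 t + flat_exp 0 (1 - t)).

Lemma flat_exp_ge0 t : 0 <= flat_exp 0 t.
Proof. by rewrite /flat_exp; case: ifP => // _; rewrite expr0 mul1r expR_ge0. Qed.

Lemma flat_exp_gt0 t : 0 < t -> 0 < flat_exp 0 t.
Proof. by move=> t0; rewrite /flat_exp t0 expr0 mul1r expR_gt0. Qed.

Lemma flat_exp_eq0 t : t <= 0 -> flat_exp 0 t = 0.
Proof. by rewrite /flat_exp leNgt => /negbTE ->. Qed.

Lemma step_den_gt0 t : 0 < flat_exp 0 t + flat_exp 0 (1 - t).
Proof.
have [t0|t0] := ltP 0 t; first by rewrite ltr_pwDl ?flat_exp_ge0 ?flat_exp_gt0.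
by rewrite ltr_wpDl ?flat_exp_ge0// flat_exp_gt0// subr_gt0 (le_lt_trans t0).
Qed.

Lemma step_eq0 t : t <= 0 -> step t = 0.
Proof. by move=> t0; rewrite /step flat_exp_eq0// mul0r. Qed.

Lemma step_eq1 t : 1 <= t -> step t = 1.
Proof.
move=> t1; rewrite /step [flat_exp 0 (1 - t)]flat_exp_eq0 ?subr_le0// addr0.
by rewrite divff// lt0r_neq0// flat_exp_gt0// (lt_le_trans _ t1).
Qed.

Lemma Ck_step k (U : set E) (u : E -> R) : open U -> Ck k U u -> Ck k U (step \o u).
Proof.
move=> oU cu; have c1 := Ck_flat_exp 0 oU cu.
have c2 := Ck_flat_exp 0 oU (CkD oU (Ck_cst k U 1) (CkN oU cu)).
apply: (CkM oU c1); apply: CkV => //; last exact: CkD oU c1 c2.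
by move=> x _; rewrite lt0r_neq0// step_den_gt0.
Qed.

Lemma bump_exists (V : set E) (x0 : E) : nbhs x0 V ->
  exists (b : E -> R) (K : set E), [/\ Cinfty setT b, \forall x \near x0, b x = 1,
    compact K, K `<=` V & forall x, ~ K x -> b x = 0].
Proof.
move=> /nbhs_ballP[r /= r0 rV].
have [d d0 dr] : exists2 d, 0 < d & d < r.
  by exists (r / 2); rewrite ?divr_gt0// ltr_pdivrMr// ltr_pMr// ltr1n.
(* The norm of [E] is the maximum of the entries, which is not smooth, so the bump is built on the
   squared Euclidean distance; outside the closed max-norm ball of radius [d] it is at least
   [d * d]. *)
pose rho (x : E) : R := \sum_(j < 4) (x 0 j - x0 0 j) * (x 0 j - x0 0 j).
(* Normalised so that [u x0 = 2], hence [u > 1] near [x0], and [u <= 0] once [rho >= d * d]. *)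
pose u (x : E) : R := 2 - (2 / (d * d)) * rho x.
have cu k : Ck k setT u.
  have cj j : Ck k setT (fun x : E => x 0 j - x0 0 j).
    exact: (CkD openT (Ck_coord k setT j) (Ck_cst k setT (- x0 0 j))).
  have cr : Ck k setT rho by apply: Ck_sum (openT) _ => j; exact: CkM openT (cj j) (cj j).
  exact: (CkD openT (Ck_cst k setT 2) (CkN openT (CkM openT (Ck_cst k setT _) cr))).
exists (step \o u), (closed_ball x0 d); split => //.
- by move=> k; exact: Ck_step openT (cu k).
- have u0 : u x0 = 2.
    by rewrite /u /rho big1 ?mulr0 ?subr0// => j _; rewrite subrr mul0r.
  have : \forall x \near x0, 1 < u x.
    have : u x @[x --> x0] --> u x0 by apply: (cu 0%N).
    by move/cvgrPdist_lt => /(_ 1 ltr01); rewrite u0; apply: filterS => x /ltr_normlW; lra.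
  by apply: filterS => x ux; rewrite /= step_eq1// ltW.
- apply: bounded_closed_compact; last exact: closed_ball_closed.
  exists (`|x0| + d); split; first exact: num_real.
  move=> m dm x; rewrite closed_ballE// /closed_ball_ /= => xd.
  rewrite -[x](subrK x0) addrC -opprB.
  by rewrite (le_trans (ler_normB _ _))// (le_trans _ (ltW dm))// lerD2l.
- move=> x xd; apply: rV; move: xd; rewrite closed_ballE// -ball_normE /closed_ball_ /=.
  by move/le_lt_trans; apply.
- move=> x nx; rewrite /= step_eq0// /u subr_le0 -mulrA.
  rewrite ler_pMr// mulrC ler_pdivlMr ?mulr_gt0// mul1r leNgt; apply/negP => rd.
  apply: nx; rewrite closed_ballE// /closed_ball_ /=.
  rewrite [leLHS]/Num.Def.normr/= mx_normrE; apply: bigmax_le; first exact: ltW.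
  move=> [i j] _; rewrite (ord1 i) /= !mxE distrC.
  rewrite -(@ler_pXn2r _ 2)// ?nnegrE// ?ltW//.
  rewrite -normrX ger0_norm ?sqr_ge0// !expr2; apply: le_lt_trans _ rd.
  rewrite /rho (bigD1 j)//= lerDl sumr_ge0// => l _; exact: sqr_ge0.
Qed.

End bump.

(** * Complex-valued functions *)

Section complex_calculus.
Variable R : realType.
Notation E := 'rV[R]_4.
Notation e_ i := (delta_mx 0 i : E).
Implicit Types (F G : E -> R[i]) (V U : set E) (x : E).

Lemma ReD (z w : R[i]) : complex.Re (z + w) = complex.Re z + complex.Re w.
Proof. by case: z; case: w. Qed.
Lemma ImD (z w : R[i]) : complex.Im (z + w) = complex.Im z + complex.Im w.
Proof. by case: z; case: w. Qed.
Lemma ReM (z w : R[i]) : complex.Re (z * w) =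
  complex.Re z * complex.Re w - complex.Im z * complex.Im w.
Proof. by case: z; case: w. Qed.
Lemma ImM (z w : R[i]) : complex.Im (z * w) =
  complex.Re z * complex.Im w + complex.Im z * complex.Re w.
Proof. by case: z; case: w. Qed.

Definition csmooth V F :=
  Cinfty V (fun x => complex.Re (F x)) /\ Cinfty V (fun x => complex.Im (F x)).

Definition cdifferentiable F x :=
  differentiable (fun x => complex.Re (F x)) x /\
  differentiable (fun x => complex.Im (F x)) x.

Definition cderiv (i : 'I_4) F x : R[i] :=
  Complex ('D_(e_ i) (fun x => complex.Re (F x)) x)
          ('D_(e_ i) (fun x => complex.Im (F x)) x).

Lemma csmooth_sub U V F : U `<=` V -> csmooth V F -> csmooth U F.
Proof. by move=> UV [r i]; split=> k; apply: (Ck_sub UV). Qed.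

Lemma eq_csmooth V F G : open V -> {in V, F =1 G} -> csmooth V F -> csmooth V G.
Proof.
by move=> oV FG [r i]; split=> k; [apply: eq_Ck (r k)|apply: eq_Ck (i k)] => //;
   move=> x /FG ->.
Qed.

Lemma csmooth_cst V (c : R[i]) : csmooth V (fun=> c).
Proof. by split=> k; apply: Ck_cst. Qed.

Lemma csmoothD V F G : open V -> csmooth V F -> csmooth V G ->
  csmooth V (fun x => F x + G x).
Proof.
move=> oV [rF iF] [rG iG]; split=> k.
  by apply: eq_Ck (CkD oV (rF k) (rG k)) => // x _; rewrite ReD.
by apply: eq_Ck (CkD oV (iF k) (iG k)) => // x _; rewrite ImD.
Qed.

Lemma csmoothM V F G : open V -> csmooth V F -> csmooth V G ->
  csmooth V (fun x => F x * G x).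
Proof.
move=> oV [rF iF] [rG iG]; split=> k.
  apply: eq_Ck (CkD oV (CkM oV (rF k) (rG k)) (CkN oV (CkM oV (iF k) (iG k)))) => //.
  by move=> x _; rewrite ReM.
apply: eq_Ck (CkD oV (CkM oV (rF k) (iG k)) (CkM oV (iF k) (rG k))) => //.
by move=> x _; rewrite ImM.
Qed.

Lemma csmoothV V F : open V -> (forall x, V x -> F x != 0) -> csmooth V F ->
  csmooth V (fun x => (F x)^-1).
Proof.
move=> oV F0 [rF iF].
pose n x := complex.Re (F x) * complex.Re (F x) + complex.Im (F x) * complex.Im (F x).
have cn k : Ck k V n by exact: CkD oV (CkM oV (rF k) (rF k)) (CkM oV (iF k) (iF k)).
have n0 x : V x -> n x != 0.
  move=> /F0; apply: contra; rewrite /n -!expr2 paddr_eq0 ?sqr_ge0// !sqrf_eq0.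
  by case: (F x) => a b /= /andP[/eqP -> /eqP ->].
have FV x : (F x)^-1 = Complex (complex.Re (F x) / n x) (- complex.Im (F x) / n x).
  by rewrite /n; case: (F x) => a b /=; rewrite -!expr2 mulNr.
split=> k.
  by apply: eq_Ck (CkM oV (rF k) (CkV oV n0 (cn k))) => // x _; rewrite FV.
by apply: eq_Ck (CkM oV (CkN oV (iF k)) (CkV oV n0 (cn k))) => // x _; rewrite FV.
Qed.

Lemma csmooth_comp U V F (t : E -> E) : open U -> (forall x, U x -> V (t x)) ->
  (forall x, U x -> {for x, continuous t}) ->
  csmooth V F -> (forall j, Cinfty U (fun x => t x 0 j)) -> csmooth U (F \o t).
Proof.
move=> oU UV tc [rF iF] ct; split=> k.
  exact: (Ck_comp oU UV tc (rF k) (fun j => ct j k)).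
exact: (Ck_comp oU UV tc (iF k) (fun j => ct j k)).
Qed.

Lemma csmooth_cderiv V F i : csmooth V F -> csmooth V (cderiv i F).
Proof. by move=> [rF iF]; split=> k; [have [_] := rF k.+1|have [_] := iF k.+1]; apply. Qed.

Lemma csmooth_cdifferentiable V F x : csmooth V F -> V x -> cdifferentiable F x.
Proof. by move=> [rF iF] Vx; split; [apply: (rF 1%N).1|apply: (iF 1%N).1]. Qed.

Lemma eq_cderiv F G x i : (\near x, F x = G x) -> cderiv i F x = cderiv i G x.
Proof.
by move=> FG; congr Complex; apply: near_eq_derive; apply: filterS FG => y ->.
Qed.

Lemma cderiv_cst (c : R[i]) x i : cderiv i (fun=> c) x = 0.
Proof. by rewrite /cderiv !derive_cst. Qed.

Lemma cderivD F G x i : cdifferentiable F x -> cdifferentiable G x ->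
  cderiv i (fun x => F x + G x) x = cderiv i F x + cderiv i G x.
Proof.
move=> [/(diff_derivable (v := e_ i)) rF /(diff_derivable (v := e_ i)) iF].
move=> [/(diff_derivable (v := e_ i)) rG /(diff_derivable (v := e_ i)) iG].
rewrite /cderiv.
have -> : (fun x => complex.Re (F x + G x)) =
    (fun x => complex.Re (F x)) + (fun x => complex.Re (G x)).
  by apply/funext => y; rewrite ReD.
have -> : (fun x => complex.Im (F x + G x)) =
    (fun x => complex.Im (F x)) + (fun x => complex.Im (G x)).
  by apply/funext => y; rewrite ImD.
by rewrite (deriveD rF rG) (deriveD iF iG).
Qed.

Lemma cderivM F G x i : cdifferentiable F x -> cdifferentiable G x ->
  cderiv i (fun x => F x * G x) x = cderiv i F x * G x + F x * cderiv i G x.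
Proof.
move=> [/(diff_derivable (v := e_ i)) rF /(diff_derivable (v := e_ i)) iF].
move=> [/(diff_derivable (v := e_ i)) rG /(diff_derivable (v := e_ i)) iG].
rewrite /cderiv.
have -> : (fun x => complex.Re (F x * G x)) =
    (fun x => complex.Re (F x)) * (fun x => complex.Re (G x))
    - (fun x => complex.Im (F x)) * (fun x => complex.Im (G x)).
  by apply/funext => y; rewrite ReM.
have -> : (fun x => complex.Im (F x * G x)) =
    (fun x => complex.Re (F x)) * (fun x => complex.Im (G x))
    + (fun x => complex.Im (F x)) * (fun x => complex.Re (G x)).
  by apply/funext => y; rewrite ImM.
rewrite (deriveB (derivableM rF rG) (derivableM iF iG)).
rewrite (deriveD (derivableM rF iG) (derivableM iF rG)).
rewrite (deriveM rF rG) (deriveM iF iG) (deriveM rF iG) (deriveM iF rG).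
move: ('D_(e_ i) _ x) ('D_(e_ i) _ x) ('D_(e_ i) _ x) ('D_(e_ i) _ x).
case: (F x) => a b; case: (G x) => c d /= p q r s.
apply/eqP; rewrite eq_complex /=; apply/andP.
split; apply/eqP.
  by rewrite [LHS](_ : _ = a * s + c * r - (b * q + d * p))//; ring.
by rewrite [LHS](_ : _ = a * q + d * r + (b * s + c * p))//; ring.
Qed.

Lemma cderiv_comp F (t : E -> E) x i : differentiable t x -> cdifferentiable F (t x) ->
  cderiv i (F \o t) x = \sum_(j < 4) real_complex R ('D_(e_ i) (fun x => t x 0 j) x)
                                     * cderiv j F (t x).
Proof.
move=> dt [rF iF].
rewrite [LHS](_ : _ = Complex
    (\sum_(j < 4) 'D_(e_ i) (fun x => t x 0 j) x *
                  'D_(e_ j) (fun x => complex.Re (F x)) (t x))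
    (\sum_(j < 4) 'D_(e_ i) (fun x => t x 0 j) x *
                  'D_(e_ j) (fun x => complex.Im (F x)) (t x))); last first.
  by congr Complex; [exact: derive_comp_row dt rF|exact: derive_comp_row dt iF].
apply/eqP; rewrite eq_complex.
rewrite (big_morph _ ReD (erefl : complex.Re (0 : R[i]) = 0)).
rewrite (big_morph _ ImD (erefl : complex.Im (0 : R[i]) = 0)).
apply/andP; split; apply/eqP; apply: eq_bigr => j _.
  by rewrite ReM /= mul0r subr0.
by rewrite ImM /= mul0r addr0.
Qed.

Lemma cschwarz F V x i j : open V -> V x -> csmooth V F ->
  cderiv i (cderiv j F) x = cderiv j (cderiv i F) x.
Proof.
move=> oV Vx [rF iF].
exact: (congr2 (@Complex R) (schwarz j i oV Vx (rF 2)) (schwarz j i oV Vx (iF 2))).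
Qed.

End complex_calculus.

(** * Charts *)

Section charts.
Variables (R : realType) (M : topologicalType) (A : manifold4 R M).
Notation E := 'rV[R]_4.
Notation e_ i := (delta_mx 0 i : E).
Implicit Types (a b c : chart_index A) (f g : M -> R[i]) (p q : M) (X Y : M -> cvec R).
Notation TJ := transition_jacobian.

(** Unlike [smooth_at], this allows any chart around [p], so that the germs at all points near [p]
    can be read in the same chart. *)
Definition smooth_in a f p := exists V : set E,
  [/\ open V, V (chart a p), V `<=` chart_cod a & csmooth V (fun x => f (chartV a x))].

Lemma smooth_atE f p : smooth_at A f p <-> smooth_in (chart_at A p) f p.
Proof.
by split=> -[V]; [case=> ? ? ? ? ?; exists V|case=> ? ? ? [? ?]; exists V]; split.
Qed.

Definition partial_in a i f p : R[i] :=
  cderiv i (fun x => f (chartV a x)) (chart a p).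

Lemma near_chart_dom a p : chart_dom a p -> \forall q \near p, chart_dom a q.
Proof. by move=> ap; apply: open_nbhs_nbhs; split=> //; exact: chart_dom_open. Qed.

Lemma near_chart_cod a p : chart_dom a p -> \forall x \near chart a p, chart_cod a x.
Proof.
by move=> ap; apply: open_nbhs_nbhs; split; [exact: chart_cod_open|exact: chartP].
Qed.

Lemma near_chartV a p (P : set M) : chart_dom a p ->
  (\forall q \near p, P q) -> \forall x \near chart a p, P (chartV a x).
Proof.
move=> ap nP; have := chartV_continuous (chartP ap).
by rewrite /prop_for /continuous_at chartK//; apply.
Qed.

Lemma near_chart a p (Q : set E) : chart_dom a p ->
  (\forall x \near chart a p, Q x) -> \forall q \near p, Q (chart a q).
Proof. by move=> ap nQ; exact: (chart_continuous ap). Qed.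

Lemma smooth_in_shrink a f p (P : set E) : smooth_in a f p ->
  (\forall x \near chart a p, P x) ->
  exists V : set E, [/\ open V, V (chart a p), V `<=` chart_cod a,
    csmooth V (fun x => f (chartV a x)) & V `<=` P].
Proof.
move=> [V [oV Vp Vc sV]] nP; exists (V `&` P°); split.
- by apply: openI => //; exact: open_interior.
- by split.
- by move=> x [/Vc].
- by apply: csmooth_sub sV => x [].
- by move=> x [_] /interior_subset.
Qed.

Lemma smooth_in2 a f g p : smooth_in a f p -> smooth_in a g p ->
  exists V : set E, [/\ open V, V (chart a p), V `<=` chart_cod a,
    csmooth V (fun x => f (chartV a x)) & csmooth V (fun x => g (chartV a x))].
Proof.
move=> sf [W [oW Wp Wc sW]].
have [|V [oV Vp Vc sV VW]] := smooth_in_shrink sf (P := W).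
  exact: open_nbhs_nbhs.
by exists V; split=> //; exact: csmooth_sub sW.
Qed.

Lemma smooth_in_near a f p : chart_dom a p -> smooth_in a f p ->
  \forall q \near p, chart_dom a q /\ smooth_in a f q.
Proof.
move=> ap [V [oV Vp Vc sV]].
have nV : \forall q \near p, V (chart a q).
  by apply: near_chart => //; exact: open_nbhs_nbhs.
apply: filterS2 (near_chart_dom ap) nV => q aq Vq; split=> //.
by exists V.
Qed.

Lemma eq_smooth_in a f g p : chart_dom a p -> (\forall q \near p, f q = g q) ->
  smooth_in a f p -> smooth_in a g p.
Proof.
move=> ap fg sf.
have [V [oV Vp Vc sV VP]] := smooth_in_shrink sf (near_chartV ap fg).
by exists V; split=> //; apply: eq_csmooth sV => // x; rewrite inE => /VP.
Qed.

Lemma smooth_in_cst a (k : R[i]) p : chart_dom a p -> smooth_in a (fun=> k) p.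
Proof.
move=> ap; exists (chart_cod a); split=> //; first exact: chart_cod_open.
  exact: chartP.
exact: csmooth_cst.
Qed.

Lemma smooth_inD a f g p : smooth_in a f p -> smooth_in a g p ->
  smooth_in a (fun q => f q + g q) p.
Proof.
move=> sf /(smooth_in2 sf)[V [oV Vp Vc fV gV]].
by exists V; split=> //; exact: csmoothD.
Qed.

Lemma smooth_inM a f g p : smooth_in a f p -> smooth_in a g p ->
  smooth_in a (fun q => f q * g q) p.
Proof.
move=> sf /(smooth_in2 sf)[V [oV Vp Vc fV gV]].
by exists V; split=> //; exact: csmoothM.
Qed.

Lemma smooth_in_cdifferentiable a f p : smooth_in a f p ->
  cdifferentiable (fun x => f (chartV a x)) (chart a p).
Proof. by move=> [V [oV Vp _ sV]]; exact: csmooth_cdifferentiable sV Vp. Qed.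

Lemma smooth_in_neq0 a f p : chart_dom a p -> smooth_in a f p -> f p != 0 ->
  \forall x \near chart a p, f (chartV a x) != 0.
Proof.
move=> ap /smooth_in_cdifferentiable[dr di] fp.
pose n x := complex.Re (f (chartV a x)) * complex.Re (f (chartV a x))
  + complex.Im (f (chartV a x)) * complex.Im (f (chartV a x)).
have cn : {for chart a p, continuous n}.
  by apply: continuousD; apply: continuousM; exact: differentiable_continuous.
have n0 : n (chart a p) != 0.
  move: fp; rewrite /n chartK//; apply: contra.
  rewrite -!expr2 paddr_eq0 ?sqr_ge0// !sqrf_eq0.
  by case: (f p) => u v /= /andP[/eqP -> /eqP ->].
have nn : \forall x \near chart a p, n x != 0 by exact: cvgr_neq0 cn n0.
apply: filterS nn => x; apply: contra => /eqP fx0.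
by rewrite /n fx0 /= !mul0r addr0.
Qed.

Lemma smooth_inV a f p : chart_dom a p -> f p != 0 -> smooth_in a f p ->
  smooth_in a (fun q => (f q)^-1) p.
Proof.
move=> ap fp sf.
have [V [oV Vp Vc sV VP]] := smooth_in_shrink sf (smooth_in_neq0 ap sf fp).
by exists V; split=> //; exact: csmoothV.
Qed.

Lemma open_transition a b :
  open [set x : E | chart_cod a x /\ chart_dom b (chartV a x)].
Proof.
rewrite openE => x /= [ax bx]; rewrite /interior.
have n1 : \forall y \near x, chart_cod a y.
  by apply: open_nbhs_nbhs; split=> //; exact: chart_cod_open.
have n2 : \forall y \near x, chart_dom b (chartV a y).
  exact: (chartV_continuous ax) (near_chart_dom bx).
exact: filterS2 n1 n2.
Qed.

(** Composition with the transition map, on the part of its domain that it sends into the set where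
    [f] is known to be smooth; that part is open by continuity of the transition. *)
Lemma smooth_in_change a b f p : chart_dom a p -> chart_dom b p ->
  smooth_in a f p -> smooth_in b f p.
Proof.
move=> ap bp [V [oV Vp Vc sV]].
pose t x := chart a (chartV b x).
pose T := [set x : E | chart_cod b x /\ chart_dom a (chartV b x)].
have tc x : T x -> {for x, continuous t}.
  move=> [bx ax]; apply: continuous_comp; first exact: chartV_continuous.
  exact: chart_continuous.
have oU : open (T `&` [set x | V (t x)]).
  rewrite openE => x [Tx Vx]; rewrite /interior.
  have n1 : \forall y \near x, T y.
    by apply: open_nbhs_nbhs; split=> //; exact: open_transition.
  have n2 : \forall y \near x, V (t y) by apply: (tc x Tx); exact: open_nbhs_nbhs.
  exact: filterS2 n1 n2.
exists (T `&` [set x | V (t x)]); split=> //.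
- split; first by split; [exact: chartP|rewrite chartK].
  by rewrite /= /t chartK.
- by move=> x [[]].
- apply: (eq_csmooth oU); last first.
    apply: (csmooth_comp (t := t) oU _ _ sV).
    + by move=> x [].
    + by move=> x [Tx _]; exact: tc.
    + by move=> j k; apply: Ck_sub (transition_smooth b a j k) => x [].
  by move=> x; rewrite inE => -[[bx ax] _] /=; rewrite /t chartK.
Qed.

Lemma smooth_in_at a f p : chart_dom a p -> smooth_in a f p -> smooth_at A f p.
Proof. by move=> ap sf; apply/smooth_atE; exact: smooth_in_change (chart_atP A p) sf. Qed.

Lemma smooth_at_in a f p : chart_dom a p -> smooth_at A f p -> smooth_in a f p.
Proof. by move=> ap /smooth_atE; exact: smooth_in_change (chart_atP A p) ap. Qed.

Lemma smooth_at_near f p : smooth_at A f p -> \forall q \near p, smooth_at A f q.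
Proof.
move=> /smooth_atE sf; apply: filterS (smooth_in_near (chart_atP A p) sf) => q [].
exact: smooth_in_at.
Qed.

Lemma smooth_in_partial a i f p : smooth_in a f p -> smooth_in a (partial_in a i f) p.
Proof.
move=> [V [oV Vp Vc sV]]; exists V; split=> //.
apply: eq_csmooth (csmooth_cderiv i sV) => // x; rewrite inE => /Vc ax.
by rewrite /partial_in chartVK.
Qed.

(** Coordinates are made complex-valued functions on [M] so that the entries of the Jacobian are
    partial derivatives of functions: their smoothness, the cocycle rule and the symmetry of their
    derivatives then follow from the lemmas on functions. *)
Definition chart_coord a j q : R[i] := real_complex R (chart a q 0 j).

Lemma smooth_in_chart_coord a b j p : chart_dom a p -> chart_dom b p ->
  smooth_in b (chart_coord a j) p.
Proof.
move=> ap bp; exists [set x | chart_cod b x /\ chart_dom a (chartV b x)]; split.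
- exact: open_transition.
- by split; [exact: chartP|rewrite chartK].
- by move=> x [].
- split; first exact: transition_smooth.
  by move=> k; exact: Ck_cst.
Qed.

Lemma transition_jacobianE a b p i j : chart_dom a p -> chart_dom b p ->
  TJ b a p i j = partial_in b i (chart_coord a j) p.
Proof.
move=> ap bp; rewrite /partial_in /cderiv !mxE derive_cst.
congr Complex; rewrite -deriveE ?derive_row//;
  apply: differentiable_row => k;
  exact: (smooth_in_cdifferentiable (smooth_in_chart_coord k ap bp)).1.
Qed.

Lemma eq_partial_in a i f g p : chart_dom a p -> (\forall q \near p, f q = g q) ->
  partial_in a i f p = partial_in a i g p.
Proof. by move=> ap fg; apply: eq_cderiv; exact: (near_chartV ap fg). Qed.

Lemma partial_in_change a b i f p : chart_dom a p -> chart_dom b p ->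
  smooth_in a f p ->
  partial_in b i f p = \sum_(j < 4) TJ b a p i j * partial_in a j f p.
Proof.
move=> ap bp sf; pose t x := chart a (chartV b x).
have tp : t (chart b p) = chart a p by rewrite /t chartK.
rewrite /partial_in (@eq_cderiv _ _ ((fun x => f (chartV a x)) \o t)); last first.
  by apply: filterS (near_chartV bp (near_chart_dom ap)) => x ax /=; rewrite /t chartK.
rewrite cderiv_comp ?tp; last exact: smooth_in_cdifferentiable.
  apply: eq_bigr => j _; congr (_ * _); rewrite transition_jacobianE//.
  by rewrite /partial_in /cderiv derive_cst.
apply: differentiable_row => k.
exact: (smooth_in_cdifferentiable (smooth_in_chart_coord k ap bp)).1.
Qed.

(** This is the change-of-chart rule [partial_in_change] applied to the coordinates of the chart
    [c]. *)
Lemma transition_jacobian_cocycle a b c p :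
  chart_dom a p -> chart_dom b p -> chart_dom c p ->
  TJ b c p = TJ b a p *m TJ a c p.
Proof.
move=> ap bp cp; apply/matrixP => i k; rewrite transition_jacobianE//.
rewrite (partial_in_change _ ap bp (smooth_in_chart_coord k cp ap)) mxE.
by apply: eq_bigr => j _; rewrite -transition_jacobianE.
Qed.

Lemma transition_jacobian_id a p : chart_dom a p -> TJ a a p = 1%:M.
Proof.
move=> ap; apply/matrixP => i k; rewrite transition_jacobianE// !mxE.
rewrite /partial_in (@eq_cderiv _ _ (fun x : E => real_complex R (x 0 k))).
  rewrite /cderiv derive_cst -(@derive_row _ id)// derive_id mxE/= eq_sym.
  by case: (i == k).
by apply: filterS (near_chart_cod ap) => x ax; rewrite /chart_coord chartVK.
Qed.

Lemma partial_in_sym a i j f p : smooth_in a f p ->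
  partial_in a i (partial_in a j f) p = partial_in a j (partial_in a i f) p.
Proof.
move=> [V [oV Vp Vc sV]].
have ext l m : partial_in a l (partial_in a m f) p
    = cderiv l (cderiv m (fun x => f (chartV a x))) (chart a p).
  apply: eq_cderiv; apply: filterS (open_nbhs_nbhs (conj oV Vp)) => x /Vc ax.
  by rewrite /partial_in chartVK.
by rewrite !ext; exact: cschwarz oV Vp sV.
Qed.

End charts.

(** * Germs of smooth functions and fields *)

Section fields.
Variables (R : realType) (M : topologicalType) (A : manifold4 R M).
Notation E := 'rV[R]_4.
Implicit Types (a b c : chart_index A) (f g : M -> R[i]) (p q : M) (X Y Z : M -> cvec R).
Notation TJ := transition_jacobian.
Notation smooth_field := (smooth_field_at A).

Lemma eq_smooth_at f g p : (\forall q \near p, f q = g q) ->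
  smooth_at A f p -> smooth_at A g p.
Proof. by move=> fg /smooth_atE sf; apply/smooth_atE; exact: eq_smooth_in (chart_atP A p) fg sf. Qed.

Lemma smooth_at_cst (k : R[i]) p : smooth_at A (fun=> k) p.
Proof. by apply/smooth_atE; exact: smooth_in_cst (chart_atP A p). Qed.

Lemma smooth_atD f g p : smooth_at A f p -> smooth_at A g p ->
  smooth_at A (fun q => f q + g q) p.
Proof. by move=> /smooth_atE sf /smooth_atE sg; apply/smooth_atE; exact: smooth_inD. Qed.

Lemma smooth_atM f g p : smooth_at A f p -> smooth_at A g p ->
  smooth_at A (fun q => f q * g q) p.
Proof. by move=> /smooth_atE sf /smooth_atE sg; apply/smooth_atE; exact: smooth_inM. Qed.

Lemma smooth_atN f p : smooth_at A f p -> smooth_at A (fun q => - f q) p.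
Proof.
move=> sf; apply: eq_smooth_at (smooth_atM (smooth_at_cst (-1) p) sf).
by near=> q; rewrite mulN1r.
Unshelve. all: by end_near. Qed.

Lemma smooth_atB f g p : smooth_at A f p -> smooth_at A g p ->
  smooth_at A (fun q => f q - g q) p.
Proof. by move=> sf sg; exact: smooth_atD sf (smooth_atN sg). Qed.

Lemma smooth_atV f p : f p != 0 -> smooth_at A f p -> smooth_at A (fun q => (f q)^-1) p.
Proof.
by move=> fp /smooth_atE sf; apply/smooth_atE; exact: smooth_inV (chart_atP A p) fp sf.
Qed.

Lemma smooth_at_sum (I : finType) (F : I -> M -> R[i]) p :
  (forall i, smooth_at A (F i) p) -> smooth_at A (fun q => \sum_i F i q) p.
Proof.
move=> sF; elim: (index_enum I) => [|i r IH].
  by apply: eq_smooth_at (smooth_at_cst 0 p); near=> q; rewrite big_nil.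
by apply: eq_smooth_at (smooth_atD (sF i) IH); near=> q; rewrite big_cons.
Unshelve. all: by end_near. Qed.

Lemma smooth_at_prod (I : finType) (F : I -> M -> R[i]) p :
  (forall i, smooth_at A (F i) p) -> smooth_at A (fun q => \prod_i F i q) p.
Proof.
move=> sF; elim: (index_enum I) => [|i r IH].
  by apply: eq_smooth_at (smooth_at_cst 1 p); near=> q; rewrite big_nil.
by apply: eq_smooth_at (smooth_atM (sF i) IH); near=> q; rewrite big_cons.
Unshelve. all: by end_near. Qed.

Lemma smooth_at_det n (F : M -> 'M[R[i]]_n) p :
  (forall i j, smooth_at A (fun q => F q i j) p) -> smooth_at A (fun q => \det (F q)) p.
Proof.
move=> sF; apply: smooth_at_sum => s; apply: smooth_atM; first exact: smooth_at_cst.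
by apply: smooth_at_prod => i.
Qed.

(** By Cramer's formula the entries of the inverse are cofactors divided by the determinant, which
    are polynomial in the entries. *)
Lemma smooth_at_invmx n (F : M -> 'M[R[i]]_n) p i j :
  (forall i j, smooth_at A (fun q => F q i j) p) ->
  (\forall q \near p, F q \in unitmx) ->
  smooth_at A (fun q => invmx (F q) i j) p.
Proof.
move=> sF uF.
have sC : smooth_at A (fun q => cofactor (F q) j i) p.
  apply: smooth_atM; first exact: smooth_at_cst.
  apply: smooth_at_det => k l; apply: eq_smooth_at (sF (lift j k) (lift i l)).
  by near=> q; rewrite !mxE.
have d0 : \det (F p) != 0 by have := nbhs_singleton uF; rewrite /= unitmxE unitfE.
apply: eq_smooth_at (smooth_atM (smooth_atV d0 (smooth_at_det sF)) sC).
by apply: filterS uF => q uq; rewrite /invmx uq !mxE.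
Unshelve. all: by end_near. Qed.

Lemma deriv_alongD p u v f :
  deriv_along A p (u + v) f = deriv_along A p u f + deriv_along A p v f.
Proof.
by rewrite /deriv_along -big_split/=; apply: eq_bigr => i _; rewrite mxE mulrDl.
Qed.

Lemma deriv_alongZ p (k : R[i]) v f :
  deriv_along A p (k *: v) f = k * deriv_along A p v f.
Proof.
by rewrite /deriv_along mulr_sumr; apply: eq_bigr => i _; rewrite mxE mulrA.
Qed.

Lemma eq_deriv_along p v f g : (\forall q \near p, f q = g q) ->
  deriv_along A p v f = deriv_along A p v g.
Proof.
move=> fg; apply: eq_bigr => i _; congr (_ * _).
exact: (eq_partial_in i (chart_atP A p) fg).
Qed.

Lemma deriv_along_cst p v (k : R[i]) : deriv_along A p v (fun=> k) = 0.
Proof.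
rewrite /deriv_along big1// => i _; rewrite [partial _ _ _ _]cderiv_cst.
exact: mulr0.
Qed.

Definition chart_differentiable f p :=
  cdifferentiable (fun x => f (chartV (chart_at A p) x)) (chart (chart_at A p) p).

Lemma smooth_at_differentiable f p : smooth_at A f p -> chart_differentiable f p.
Proof. by move=> /smooth_atE; exact: smooth_in_cdifferentiable. Qed.

Lemma partialD p i f g : chart_differentiable f p -> chart_differentiable g p ->
  partial A i (fun q => f q + g q) p = partial A i f p + partial A i g p.
Proof. exact: cderivD. Qed.

Lemma partialM p i f g : chart_differentiable f p -> chart_differentiable g p ->
  partial A i (fun q => f q * g q) p = partial A i f p * g p + f p * partial A i g p.
Proof.
move=> df dg; rewrite -[in g p](chartK (chart_atP A p)) -[in f p](chartK (chart_atP A p)).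
exact: cderivM.
Qed.

Lemma deriv_along_addf p v f g : chart_differentiable f p -> chart_differentiable g p ->
  deriv_along A p v (fun q => f q + g q) = deriv_along A p v f + deriv_along A p v g.
Proof.
move=> df dg; rewrite /deriv_along -big_split/=; apply: eq_bigr => i _.
by rewrite partialD// mulrDr.
Qed.

Lemma deriv_along_mulf p v f g : chart_differentiable f p -> chart_differentiable g p ->
  deriv_along A p v (fun q => f q * g q) =
  deriv_along A p v f * g p + f p * deriv_along A p v g.
Proof.
move=> df dg; rewrite /deriv_along mulr_suml mulr_sumr -big_split/=.
apply: eq_bigr => i _.
by rewrite partialM// mulrDr mulrA [v 0 i * (f p * _)]mulrCA.
Qed.

Lemma component_at X q j : component X (chart_at A q) j q = X q 0 j.
Proof.
by rewrite /component transition_jacobian_id ?mulmx1//; exact: chart_atP.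
Qed.

Lemma component_change X a b j q : chart_dom a q -> chart_dom b q ->
  component X b j q = \sum_(i < 4) component X a i q * TJ a b q i j.
Proof.
move=> aq bq.
rewrite [LHS]/component (transition_jacobian_cocycle aq (chart_atP A q) bq).
by rewrite mulmxA [LHS]mxE.
Qed.

Lemma componentD X Y a j q :
  component (fun q => X q + Y q) a j q = component X a j q + component Y a j q.
Proof. by rewrite /component mulmxDl mxE. Qed.

Lemma componentZ f X a j q :
  component (fun q => f q *: X q) a j q = f q * component X a j q.
Proof. by rewrite /component -scalemxAl mxE. Qed.

Definition smooth_field_in a X p := forall j, smooth_in a (component X a j) p.

Lemma smooth_in_transition a b p i j : chart_dom a p -> chart_dom b p ->
  smooth_in a (fun q => TJ a b q i j) p.
Proof.
move=> ap bp; apply: (eq_smooth_in ap _ (smooth_in_partial i (smooth_in_chart_coord j bp ap))).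
by apply: filterS2 (near_chart_dom ap) (near_chart_dom bp) => q aq bq;
  rewrite transition_jacobianE.
Qed.

Lemma smooth_field_in_change a b X p : chart_dom a p -> chart_dom b p ->
  smooth_field_in a X p -> smooth_field_in b X p.
Proof.
move=> ap bp sX j; apply: (smooth_in_change ap bp).
apply: (@eq_smooth_in _ _ _ _ (fun q => \sum_(i < 4) component X a i q * TJ a b q i j)) => //.
  by apply: filterS2 (near_chart_dom ap) (near_chart_dom bp) => q aq bq;
    rewrite -component_change.
apply: (smooth_at_in ap); apply: smooth_at_sum => i.
by apply: (smooth_in_at ap); apply: smooth_inM => //; exact: smooth_in_transition.
Qed.

Lemma smooth_field_atE X p : smooth_field X p <-> smooth_field_in (chart_at A p) X p.
Proof. by split=> sX j; apply/smooth_atE. Qed.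

Lemma smooth_field_in_at a X p : chart_dom a p -> smooth_field_in a X p -> smooth_field X p.
Proof.
by move=> ap sX; apply/smooth_field_atE; exact: smooth_field_in_change (chart_atP A p) sX.
Qed.

Lemma smooth_field_at_in a X p : chart_dom a p -> smooth_field X p -> smooth_field_in a X p.
Proof.
by move=> ap /smooth_field_atE; exact: smooth_field_in_change (chart_atP A p) ap.
Qed.

Lemma smooth_component a X p j : chart_dom a p -> smooth_field X p ->
  smooth_at A (component X a j) p.
Proof. by move=> ap sX; apply: (smooth_in_at ap); exact: smooth_field_at_in. Qed.

Lemma smooth_field_near X p : smooth_field X p -> \forall q \near p, smooth_field X q.
Proof.
move=> sX; set a := chart_at A p; have ap : chart_dom a p := chart_atP A p.
have H j : \forall q \near p, smooth_in a (component X a j) q.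
  by apply: filterS (smooth_in_near ap (smooth_field_at_in ap sX j)) => q [].
near=> q; apply: (@smooth_field_in_at a); first by near: q; exact: near_chart_dom.
by move=> j; move: j; near: q; apply: filter_forall.
Unshelve. all: by end_near. Qed.

Lemma eq_smooth_field X Y p : (\forall q \near p, X q = Y q) ->
  smooth_field X p -> smooth_field Y p.
Proof.
move=> XY sX j; apply: eq_smooth_at (sX j).
by apply: filterS XY => q XYq; rewrite /component XYq.
Qed.

Lemma smooth_fieldD X Y p : smooth_field X p -> smooth_field Y p ->
  smooth_field (fun q => X q + Y q) p.
Proof.
move=> sX sY j; apply: eq_smooth_at (smooth_atD (sX j) (sY j)).
by near=> q; rewrite componentD.
Unshelve. all: by end_near. Qed.

Lemma smooth_fieldZ f X p : smooth_at A f p -> smooth_field X p ->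
  smooth_field (fun q => f q *: X q) p.
Proof.
move=> sf sX j; apply: eq_smooth_at (smooth_atM sf (sX j)).
by near=> q; rewrite componentZ.
Unshelve. all: by end_near. Qed.

Lemma smooth_field0 p : smooth_field (fun=> 0) p.
Proof.
move=> j; apply: eq_smooth_at (smooth_at_cst 0 p).
by near=> q; rewrite /component mul0mx mxE.
Unshelve. all: by end_near. Qed.

Lemma smooth_field_sum (I : finType) (F : I -> M -> cvec R) p :
  (forall i, smooth_field (F i) p) -> smooth_field (fun q => \sum_i F i q) p.
Proof.
move=> sF; elim: (index_enum I) => [|i r IH].
  by apply: eq_smooth_field (smooth_field0 p); near=> q; rewrite big_nil.
by apply: eq_smooth_field (smooth_fieldD (sF i) IH); near=> q; rewrite big_cons.
Unshelve. all: by end_near. Qed.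

Lemma deriv_alongE a q (v : cvec R) f : chart_dom a q -> smooth_at A f q ->
  deriv_along A q v f =
  \sum_(j < 4) (v *m TJ (chart_at A q) a q) 0 j * partial_in a j f q.
Proof.
move=> aq sf; rewrite /deriv_along.
under eq_bigr => i _.
  rewrite [partial _ _ _ _](partial_in_change i aq (chart_atP A q) (smooth_at_in aq sf)).
  rewrite mulr_sumr; over.
rewrite exchange_big; apply: eq_bigr => j _ /=; rewrite mxE mulr_suml.
by apply: eq_bigr => i _; rewrite mulrA.
Qed.

(** By definition the derivative at [q] is taken in [chart_at A q], which varies with [q] without
    any continuity; [deriv_alongE] rewrites it near [p] in the single chart of [p]. *)
Lemma smooth_deriv_along X f p : smooth_field X p -> smooth_at A f p ->
  smooth_at A (fun q => deriv_along A q (X q) f) p.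
Proof.
move=> sX sf; set a := chart_at A p; have ap : chart_dom a p := chart_atP A p.
apply: (@eq_smooth_at (fun q => \sum_(j < 4) component X a j q * partial_in a j f q)).
  by apply: filterS2 (near_chart_dom ap) (smooth_at_near sf) => q aq sq;
    rewrite (deriv_alongE _ aq sq).
apply: smooth_at_sum => j; apply: smooth_atM; first exact: sX.
by apply: (smooth_in_at ap); apply: smooth_in_partial; apply: smooth_at_in.
Qed.

End fields.

(** * Lie brackets *)

Section brackets.
Variables (R : realType) (M : topologicalType) (A : manifold4 R M).
Notation E := 'rV[R]_4.
Implicit Types (a b c : chart_index A) (f g : M -> R[i]) (p q : M) (X Y Z : M -> cvec R).
Notation TJ := transition_jacobian.
Notation smooth_field := (smooth_field_at A).

Lemma deriv_along_sumf (I : finType) (F : I -> M -> R[i]) p v :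
  (forall i, smooth_at A (F i) p) ->
  deriv_along A p v (fun q => \sum_i F i q) = \sum_i deriv_along A p v (F i).
Proof.
move=> sF.
suff [_ ->] : smooth_at A (fun q => \sum_i F i q) p /\
  deriv_along A p v (fun q => \sum_i F i q) = \sum_i deriv_along A p v (F i) by [].
elim: (index_enum I) => [|i r [sr IH]].
  split; first by apply: eq_smooth_at (smooth_at_cst A 0 p); near=> q; rewrite big_nil.
  rewrite [RHS]big_nil -[RHS](deriv_along_cst A p v 0); apply: eq_deriv_along.
  by near=> q; rewrite big_nil.
have Ei : \forall q \near p, F i q + \sum_(j <- r) F j q = \sum_(j <- i :: r) F j q.
  by near=> q; rewrite big_cons.
split; first exact: eq_smooth_at Ei (smooth_atD (sF i) sr).
rewrite big_cons -IH -(eq_deriv_along A v Ei) deriv_along_addf//;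
  exact: smooth_at_differentiable.
Unshelve. all: by end_near. Qed.

(* The terms containing derivatives of the Jacobian cancel by the symmetry of
   second derivatives. *)
Lemma component_lie_bracket X Y a j q : chart_dom a q ->
  smooth_field X q -> smooth_field Y q ->
  component (lie_bracket A X Y) a j q =
  deriv_along A q (X q) (component Y a j) - deriv_along A q (Y q) (component X a j).
Proof.
move=> aq sX sY; set c := chart_at A q; have cq : chart_dom c q := chart_atP A q.
pose T i := fun r => TJ c a r i j.
have sT i : smooth_at A (T i) q by apply/smooth_atE; exact: smooth_in_transition.
pose P k i := partial_in c k (partial_in c i (chart_coord a j)) q.
have DT v i : deriv_along A q v (T i) = \sum_(k < 4) v 0 k * P k i.
  apply: eq_bigr => k _; congr (_ * _); apply: (eq_partial_in k cq).
  by apply: filterS2 (near_chart_dom cq) (near_chart_dom aq) => r cr ar;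
    rewrite /T transition_jacobianE.
have D v (Z : M -> cvec R) : smooth_field Z q -> deriv_along A q v (component Z a j) =
    \sum_(i < 4) deriv_along A q v (component Z c i) * T i q
    + \sum_(i < 4) Z q 0 i * \sum_(k < 4) v 0 k * P k i.
  move=> sZ.
  rewrite (@eq_deriv_along _ _ _ _ _ _ (fun r => \sum_(i < 4) component Z c i r * T i r)).
    rewrite deriv_along_sumf => [|i]; last by apply: smooth_atM; [exact: sZ|exact: sT].
    rewrite -big_split/=; apply: eq_bigr => i _.
    rewrite deriv_along_mulf; [|exact/smooth_at_differentiable..].
    by rewrite component_at DT.
  by apply: filterS2 (near_chart_dom cq) (near_chart_dom aq) => r cr ar;
    rewrite -component_change.
rewrite (D _ _ sX) (D _ _ sY) opprD addrACA -sumrB.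
rewrite [X in _ = _ + X](_ : _ = 0); last first.
  apply/eqP; rewrite subr_eq0; apply/eqP.
  under eq_bigr => i _ do rewrite mulr_sumr.
  under [RHS]eq_bigr => i _ do rewrite mulr_sumr.
  rewrite exchange_big/=; apply: eq_bigr => i _; apply: eq_bigr => k _.
  have -> : P i k = P k i by exact: partial_in_sym (smooth_in_chart_coord j aq cq).
  exact: mulrCA.
rewrite addr0 [LHS]mxE; apply: eq_bigr => i _.
by rewrite mxE mulrBl.
Qed.

Lemma smooth_lie_bracket X Y p : smooth_field X p -> smooth_field Y p ->
  smooth_field (lie_bracket A X Y) p.
Proof.
move=> sX sY j; set a := chart_at A p; have ap : chart_dom a p := chart_atP A p.
apply: (@eq_smooth_at _ _ _ (fun q => deriv_along A q (X q) (component Y a j) -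
                                      deriv_along A q (Y q) (component X a j))).
  by apply: filterS3 (near_chart_dom ap) (smooth_field_near sX) (smooth_field_near sY)
    => q aq sXq sYq; rewrite component_lie_bracket.
by apply: smooth_atB; apply: smooth_deriv_along => //; exact: smooth_component.
Qed.

Lemma lie_bracketC X Y p : lie_bracket A X Y p = - lie_bracket A Y X p.
Proof. by apply/rowP => j; rewrite !mxE opprB. Qed.

Lemma lie_bracketDr X Y Z p : smooth_field Y p -> smooth_field Z p ->
  lie_bracket A X (fun q => Y q + Z q) p = lie_bracket A X Y p + lie_bracket A X Z p.
Proof.
move=> sY sZ; apply/rowP => j; rewrite !mxE deriv_alongD.
rewrite (@eq_deriv_along _ _ _ _ _ _ (fun q => component Y (chart_at A p) j q
  + component Z (chart_at A p) j q)); last by near=> q; rewrite componentD.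
rewrite deriv_along_addf; [|exact/smooth_at_differentiable..].
by rewrite opprD addrACA.
Unshelve. all: by end_near. Qed.

Lemma lie_bracketZr f X Y p : smooth_at A f p -> smooth_field Y p ->
  lie_bracket A X (fun q => f q *: Y q) p =
  deriv_along A p (X p) f *: Y p + f p *: lie_bracket A X Y p.
Proof.
move=> sf sY; apply/rowP => j; rewrite !mxE deriv_alongZ.
rewrite (@eq_deriv_along _ _ _ _ _ _ (fun q => f q * component Y (chart_at A p) j q));
  last by near=> q; rewrite componentZ.
rewrite deriv_along_mulf; [|exact/smooth_at_differentiable..].
by rewrite component_at -addrA mulrBr.
Unshelve. all: by end_near. Qed.

Lemma lie_bracketDl X Y Z p : smooth_field Y p -> smooth_field Z p ->
  lie_bracket A (fun q => Y q + Z q) X p = lie_bracket A Y X p + lie_bracket A Z X p.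
Proof.
by move=> sY sZ; rewrite lie_bracketC lie_bracketDr// opprD -!(lie_bracketC _ X).
Qed.

Lemma lie_bracketZl f X Y p : smooth_at A f p -> smooth_field Y p ->
  lie_bracket A (fun q => f q *: Y q) X p =
  f p *: lie_bracket A Y X p - deriv_along A p (X p) f *: Y p.
Proof.
move=> sf sY; rewrite lie_bracketC lie_bracketZr// opprD addrC.
by rewrite (lie_bracketC Y) scalerN.
Qed.

Lemma eq_lie_bracket X X' Y Y' p : (\forall q \near p, X q = X' q) ->
  (\forall q \near p, Y q = Y' q) -> lie_bracket A X Y p = lie_bracket A X' Y' p.
Proof.
move=> XX YY; apply/rowP => j; rewrite [LHS]mxE [RHS]mxE.
have -> : X p = X' p := nbhs_singleton XX.
have -> : Y p = Y' p := nbhs_singleton YY.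
have EX : \forall q \near p, component X (chart_at A p) j q = component X' (chart_at A p) j q.
  by apply: filterS XX => q XXq; rewrite /component XXq.
have EY : \forall q \near p, component Y (chart_at A p) j q = component Y' (chart_at A p) j q.
  by apply: filterS YY => q YYq; rewrite /component YYq.
by rewrite (eq_deriv_along A _ EX) (eq_deriv_along A _ EY).
Qed.

(** The coordinate field [d/dx^k] of the chart [a]. The Jacobian appears because a vector at [q] is
    stored by its components in [chart_at A q]. *)
Definition coord_field a k q : cvec R := row k (TJ a (chart_at A q) q).

Lemma component_coord_field a b k j q : chart_dom a q -> chart_dom b q ->
  component (coord_field a k) b j q = TJ a b q k j.
Proof.
move=> aq bq; rewrite /component /coord_field -row_mul mxE.
by rewrite -(transition_jacobian_cocycle (chart_atP A q) aq bq).
Qed.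

Lemma smooth_coord_field a k p : chart_dom a p -> smooth_field (coord_field a k) p.
Proof.
move=> ap; apply: (smooth_field_in_at ap) => j.
apply: (eq_smooth_in ap _ (smooth_in_cst ((k == j)%:R) ap)).
by apply: filterS (near_chart_dom ap) => q aq;
  rewrite component_coord_field// transition_jacobian_id// mxE.
Qed.

Lemma coord_field_sum X a q : chart_dom a q ->
  X q = \sum_(k < 4) component X a k q *: coord_field a k q.
Proof.
move=> aq; have cq := chart_atP A q; set T := TJ (chart_at A q) a q.
have -> : X q = X q *m T *m TJ a (chart_at A q) q.
  by rewrite -mulmxA -(transition_jacobian_cocycle aq cq cq) transition_jacobian_id// mulmx1.
by rewrite mulmx_sum_row.
Qed.

Lemma coord_field_at k q : coord_field (chart_at A q) k q = delta_mx 0 k.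
Proof. by rewrite /coord_field transition_jacobian_id ?row1//; exact: chart_atP. Qed.

(** The extension of [v] with constant components in the chart of [p]: it supplies a smooth field
    wherever an identity for fields is to be used at a single vector. *)
Definition extend_vector p (v : cvec R) q : cvec R :=
  \sum_(k < 4) v 0 k *: coord_field (chart_at A p) k q.

Lemma smooth_extend_vector p v : smooth_field (extend_vector p v) p.
Proof.
apply: smooth_field_sum => k; apply: smooth_fieldZ; first exact: smooth_at_cst.
exact/smooth_coord_field/chart_atP.
Qed.

Lemma extend_vector_at p v : extend_vector p v p = v.
Proof.
rewrite [RHS]row_sum_delta; apply: eq_bigr => k _; by rewrite coord_field_at.
Qed.

End brackets.

(** * Koszul formula and Weyl connections *)

Section pairing.
Variables (R : realType) (M : Type) (g : M -> 'M[R[i]]_4).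
Implicit Types (p : M) (u v w : cvec R) (k : R[i]).

Lemma pairingDl p u v w : pairing g p (u + v) w = pairing g p u w + pairing g p v w.
Proof. by rewrite /pairing !mulmxDl mxE. Qed.

Lemma pairingZl p k u w : pairing g p (k *: u) w = k * pairing g p u w.
Proof. by rewrite /pairing -!scalemxAl mxE. Qed.

Lemma pairingDr p u v w : pairing g p w (u + v) = pairing g p w u + pairing g p w v.
Proof. by rewrite /pairing linearD mulmxDr mxE. Qed.

Lemma pairingZr p k u w : pairing g p w (k *: u) = k * pairing g p w u.
Proof. by rewrite /pairing linearZ -scalemxAr mxE. Qed.

Lemma pairingNl p u w : pairing g p (- u) w = - pairing g p u w.
Proof. by rewrite -scaleN1r pairingZl mulN1r. Qed.

Lemma pairingNr p u w : pairing g p w (- u) = - pairing g p w u.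
Proof. by rewrite -scaleN1r pairingZr mulN1r. Qed.

Lemma pairing_suml p (I : finType) (F : I -> cvec R) w :
  pairing g p (\sum_i F i) w = \sum_i pairing g p (F i) w.
Proof. by rewrite /pairing !mulmx_suml summxE. Qed.

End pairing.

Section form_eval.
Variables (R : realType) (M : Type) (B : M -> 'cV[R[i]]_4).
Implicit Types (p : M) (u v w : cvec R) (k : R[i]).

Lemma form_evalD p u v : form_eval B p (u + v) = form_eval B p u + form_eval B p v.
Proof. by rewrite /form_eval mulmxDl mxE. Qed.

Lemma form_evalZ p k u : form_eval B p (k *: u) = k * form_eval B p u.
Proof. by rewrite /form_eval -scalemxAl mxE. Qed.

End form_eval.

(* [rewrite] and [ring] compare terms up to conversion, which is very slow on
   derivatives; these tactics only match syntactically. *)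
Ltac replace_atom t u pf :=
  let H := fresh in
  assert (H : t = u) by exact pf; revert H; generalize t; intros ? ->.

Ltac subst_atom pf :=
  let H := fresh in pose proof pf as H;
  match type of H with ?t = _ => revert H; generalize t; intros ? -> end.

Ltac expand_linear :=
  repeat match goal with
  | |- context [pairing ?g ?p ?x ?w] =>
    match x with
    | @GRing.scale _ _ ?k ?u =>
      replace_atom (pairing g p x w) (k * pairing g p u w) (pairingZl g p k u w)
    | @GRing.add _ ?u ?v =>
      replace_atom (pairing g p x w) (pairing g p u w + pairing g p v w) (pairingDl g p u v w)
    | @GRing.opp _ ?u =>
      replace_atom (pairing g p x w) (- pairing g p u w) (pairingNl g p u w)
    end
  | |- context [pairing ?g ?p ?w ?x] =>
    match x with
    | @GRing.scale _ _ ?k ?u =>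
      replace_atom (pairing g p w x) (k * pairing g p w u) (pairingZr g p k u w)
    | @GRing.add _ ?u ?v =>
      replace_atom (pairing g p w x) (pairing g p w u + pairing g p w v) (pairingDr g p u v w)
    | @GRing.opp _ ?u =>
      replace_atom (pairing g p w x) (- pairing g p w u) (pairingNr g p u w)
    end
  | |- context [deriv_along ?A ?p ?x ?f] =>
    match x with
    | @GRing.scale _ _ ?k ?u =>
      replace_atom (deriv_along A p x f) (k * deriv_along A p u f) (deriv_alongZ A p k u f)
    | @GRing.add _ ?u ?v =>
      replace_atom (deriv_along A p x f) (deriv_along A p u f + deriv_along A p v f)
        (deriv_alongD A p u v f)
    end
  | |- context [form_eval ?B ?p ?x] =>
    match x with
    | @GRing.scale _ _ ?k ?u =>
      replace_atom (form_eval B p x) (k * form_eval B p u) (form_evalZ B p k u)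
    | @GRing.add _ ?u ?v =>
      replace_atom (form_eval B p x) (form_eval B p u + form_eval B p v) (form_evalD B p u v)
    end
  end.

Ltac ring_atoms :=
  repeat match goal with
  | |- context [deriv_along ?A ?p ?v ?f] => generalize (deriv_along A p v f); intro
  | |- context [pairing ?g ?p ?u ?v] => generalize (pairing g p u v); intro
  | |- context [form_eval ?B ?p ?v] => generalize (form_eval B p v); intro
  end; ring.

Section koszul_form.
Variables (R : realType) (M : topologicalType) (A : manifold4 R M).
Variables (g : M -> 'M[R[i]]_4) (hg : is_metric A g).
Implicit Types (a b c : chart_index A) (f : M -> R[i]) (p q : M) (X Y Z : M -> cvec R)
  (B : M -> 'cV[R[i]]_4).
Notation smooth_field := (smooth_field_at A).
Notation D := (deriv_along A).

Let gC p u v : pairing g p u v = pairing g p v u.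
Proof. by case: hg => + _ _; apply. Qed.

Lemma metric_nondegenerate p u : (forall v, pairing g p u v = 0) -> u = 0.
Proof. by case: hg => _ + _; apply. Qed.

Let sg p X Y : smooth_field X p -> smooth_field Y p ->
  smooth_at A (fun q => pairing g q (X q) (Y q)) p.
Proof. by case: hg => _ _; apply. Qed.

Let two_neq0 : (2 : R[i]) != 0. Proof. by rewrite pnatr_eq0. Qed.

(* Twice g(nabla_X Y, Z) for the torsion-free nabla with nabla g = - B g. *)
Definition koszul_form B X Y Z p : R[i] :=
  D p (X p) (fun q => pairing g q (Y q) (Z q))
  + D p (Y p) (fun q => pairing g q (X q) (Z q))
  - D p (Z p) (fun q => pairing g q (X q) (Y q))
  + pairing g p (lie_bracket A X Y p) (Z p)
  - pairing g p (lie_bracket A X Z p) (Y p)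
  - pairing g p (lie_bracket A Y Z p) (X p)
  + form_eval B p (X p) * pairing g p (Y p) (Z p)
  + form_eval B p (Y p) * pairing g p (X p) (Z p)
  - form_eval B p (Z p) * pairing g p (X p) (Y p).

Lemma eq_koszul B X X' Y Y' Z Z' p :
  (\forall q \near p, X q = X' q) -> (\forall q \near p, Y q = Y' q) ->
  (\forall q \near p, Z q = Z' q) -> koszul_form B X Y Z p = koszul_form B X' Y' Z' p.
Proof.
move=> XX YY ZZ; rewrite /koszul_form.
rewrite (eq_lie_bracket A XX YY) (eq_lie_bracket A XX ZZ) (eq_lie_bracket A YY ZZ).
have EXY : \forall q \near p, pairing g q (X q) (Y q) = pairing g q (X' q) (Y' q).
  by apply: filterS2 XX YY => q -> ->.
have EXZ : \forall q \near p, pairing g q (X q) (Z q) = pairing g q (X' q) (Z' q).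
  by apply: filterS2 XX ZZ => q -> ->.
have EYZ : \forall q \near p, pairing g q (Y q) (Z q) = pairing g q (Y' q) (Z' q).
  by apply: filterS2 YY ZZ => q -> ->.
rewrite (eq_deriv_along A _ EXY) (eq_deriv_along A _ EXZ) (eq_deriv_along A _ EYZ).
by rewrite (nbhs_singleton XX) (nbhs_singleton YY) (nbhs_singleton ZZ).
Qed.

(** Only the bracket of [X] and [Y] is not symmetric under their exchange. This identity encodes the
    vanishing of torsion, and it also transfers the rules for the slot [Y] to the slot [X]. *)
Lemma koszul_torsion B X Y Z p :
  koszul_form B X Y Z p = koszul_form B Y X Z p + 2 * pairing g p (lie_bracket A X Y p) (Z p).
Proof.
rewrite /koszul_form (lie_bracketC A Y X) pairingNl (gC p (Y p) (X p)).
rewrite (@eq_deriv_along _ _ _ p _ (fun q => pairing g q (Y q) (X q))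
  (fun q => pairing g q (X q) (Y q))); last by near=> q; rewrite gC.
by ring_atoms.
Unshelve. all: by end_near. Qed.

(** Symmetrising in the last two slots leaves only the derivative of [g(Y, Z)] and the term in
    [B(X)]: this encodes [nabla g = - B g], and it transfers the rules for the slot [Y] to the slot
    [Z]. *)
Lemma koszul_metric B X Y Z p : koszul_form B X Z Y p =
  2 * (D p (X p) (fun q => pairing g q (Y q) (Z q))
       + form_eval B p (X p) * pairing g p (Y p) (Z p)) - koszul_form B X Y Z p.
Proof.
rewrite /koszul_form (lie_bracketC A Z Y) pairingNl (gC p (Z p) (Y p)).
rewrite (@eq_deriv_along _ _ _ p _ (fun q => pairing g q (Z q) (Y q))
  (fun q => pairing g q (Y q) (Z q))); last by near=> q; rewrite gC.
by ring_atoms.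
Unshelve. all: by end_near. Qed.

Lemma koszulY_scale B f X Y Z p : smooth_at A f p ->
  smooth_field X p -> smooth_field Y p -> smooth_field Z p ->
  koszul_form B X (fun q => f q *: Y q) Z p =
  f p * koszul_form B X Y Z p + 2 * D p (X p) f * pairing g p (Y p) (Z p).
Proof.
move=> sf sX sY sZ; rewrite /koszul_form lie_bracketZr// lie_bracketZl//.
rewrite (@eq_deriv_along _ _ _ p _ (fun q => pairing g q (f q *: Y q) (Z q))
  (fun q => f q * pairing g q (Y q) (Z q))); last by near=> q; rewrite pairingZl.
rewrite (@eq_deriv_along _ _ _ p _ (fun q => pairing g q (X q) (f q *: Y q))
  (fun q => f q * pairing g q (X q) (Y q))); last by near=> q; rewrite pairingZr.
rewrite !deriv_along_mulf; try exact/smooth_at_differentiable/sg;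
  try exact: smooth_at_differentiable.
expand_linear.
rewrite (gC p (Y p) (X p)).
by ring_atoms.
Unshelve. all: by end_near. Qed.

Lemma koszulY_add B X Y Y' Z p :
  smooth_field X p -> smooth_field Y p -> smooth_field Y' p -> smooth_field Z p ->
  koszul_form B X (fun q => Y q + Y' q) Z p = koszul_form B X Y Z p + koszul_form B X Y' Z p.
Proof.
move=> sX sY sY' sZ; rewrite /koszul_form lie_bracketDr// lie_bracketDl//.
rewrite (@eq_deriv_along _ _ _ p _ (fun q => pairing g q (Y q + Y' q) (Z q))
  (fun q => pairing g q (Y q) (Z q) + pairing g q (Y' q) (Z q)));
  last by near=> q; rewrite pairingDl.
rewrite (@eq_deriv_along _ _ _ p _ (fun q => pairing g q (X q) (Y q + Y' q))
  (fun q => pairing g q (X q) (Y q) + pairing g q (X q) (Y' q)));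
  last by near=> q; rewrite pairingDr.
rewrite !deriv_along_addf; try exact/smooth_at_differentiable/sg.
expand_linear.
by ring_atoms.
Unshelve. all: by end_near. Qed.

(** After exchanging [X] and [Y], the Leibniz term of [koszulY_scale] cancels against the derivative
    of [f] produced by the bracket. *)
Lemma koszulX_scale B f X Y Z p : smooth_at A f p ->
  smooth_field X p -> smooth_field Y p -> smooth_field Z p ->
  koszul_form B (fun q => f q *: X q) Y Z p = f p * koszul_form B X Y Z p.
Proof.
move=> sf sX sY sZ; rewrite koszul_torsion koszulY_scale// lie_bracketZl//.
expand_linear; rewrite (koszul_torsion B X Y).
by ring_atoms.
Qed.

Lemma koszulX_add B X X' Y Z p :
  smooth_field X p -> smooth_field X' p -> smooth_field Y p -> smooth_field Z p ->
  koszul_form B (fun q => X q + X' q) Y Z p = koszul_form B X Y Z p + koszul_form B X' Y Z p.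
Proof.
move=> sX sX' sY sZ; rewrite koszul_torsion koszulY_add// lie_bracketDl//.
expand_linear; rewrite (koszul_torsion B X Y) (koszul_torsion B X' Y).
by ring_atoms.
Qed.

Lemma koszulZ_scale B f X Y Z p : smooth_at A f p ->
  smooth_field X p -> smooth_field Y p -> smooth_field Z p ->
  koszul_form B X Y (fun q => f q *: Z q) p = f p * koszul_form B X Y Z p.
Proof.
move=> sf sX sY sZ; rewrite koszul_metric koszulY_scale// (koszul_metric B X Y).
rewrite (@eq_deriv_along _ _ _ p _ (fun q => pairing g q (f q *: Z q) (Y q))
  (fun q => f q * pairing g q (Y q) (Z q))); last by near=> q; rewrite pairingZl gC.
rewrite deriv_along_mulf; try exact/smooth_at_differentiable/sg;
  try exact: smooth_at_differentiable.
expand_linear; rewrite (gC p (Z p) (Y p)).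
by ring_atoms.
Unshelve. all: by end_near. Qed.

Lemma koszulZ_add B X Y Z Z' p :
  smooth_field X p -> smooth_field Y p -> smooth_field Z p -> smooth_field Z' p ->
  koszul_form B X Y (fun q => Z q + Z' q) p = koszul_form B X Y Z p + koszul_form B X Y Z' p.
Proof.
move=> sX sY sZ sZ'; rewrite koszul_metric koszulY_add//.
rewrite (koszul_metric B X Y Z) (koszul_metric B X Y Z').
rewrite (@eq_deriv_along _ _ _ p _ (fun q => pairing g q (Z q + Z' q) (Y q))
  (fun q => pairing g q (Y q) (Z q) + pairing g q (Y q) (Z' q)));
  last by near=> q; rewrite gC pairingDr.
rewrite deriv_along_addf; try exact/smooth_at_differentiable/sg.
expand_linear; rewrite (gC p (Z p) (Y p)) (gC p (Z' p) (Y p)).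
by ring_atoms.
Unshelve. all: by end_near. Qed.

Lemma koszulX_sum B (I : finType) (f : I -> M -> R[i]) (F : I -> M -> cvec R) Y Z p :
  (forall i, smooth_at A (f i) p) -> (forall i, smooth_field (F i) p) ->
  smooth_field Y p -> smooth_field Z p ->
  koszul_form B (fun q => \sum_i f i q *: F i q) Y Z p = \sum_i f i p * koszul_form B (F i) Y Z p.
Proof.
move=> sf sF sY sZ.
have sfF i := smooth_fieldZ (sf i) (sF i).
pose S r q := \sum_(i <- r) f i q *: F i q.
suff [_ ->] : smooth_field (S (index_enum I)) p /\
  koszul_form B (S (index_enum I)) Y Z p = \sum_i f i p * koszul_form B (F i) Y Z p by [].
elim: (index_enum I) => [|i r [sr IH]].
  have E0 : \forall q \near p, (fun=> 0) q = S [::] q by near=> q; rewrite /S big_nil.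
  split; first exact: eq_smooth_field E0 (smooth_field0 A p).
  have EE : \forall q \near p, S [::] q = (fun=> 0 : R[i]) q *: (fun=> 0 : cvec R) q.
    by near=> q; rewrite /S big_nil scale0r.
  rewrite big_nil (eq_koszul B EE (Y' := Y) (Z' := Z)); try by near=> q.
  rewrite koszulX_scale//; first exact: mul0r.
    exact: smooth_at_cst.
  exact: smooth_field0.
have Ei : \forall q \near p, f i q *: F i q + S r q = S (i :: r) q.
  by near=> q; rewrite /S big_cons.
split; first exact: eq_smooth_field Ei (smooth_fieldD (sfF i) sr).
rewrite big_cons -IH -(eq_koszul B Ei (Y := Y) (Z := Z)); try by near=> q.
by rewrite koszulX_add// koszulX_scale.
Unshelve. all: by end_near. Qed.

Lemma koszulZ_sum B (I : finType) (f : I -> M -> R[i]) (F : I -> M -> cvec R) X Y p :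
  (forall i, smooth_at A (f i) p) -> (forall i, smooth_field (F i) p) ->
  smooth_field X p -> smooth_field Y p ->
  koszul_form B X Y (fun q => \sum_i f i q *: F i q) p = \sum_i f i p * koszul_form B X Y (F i) p.
Proof.
move=> sf sF sX sY.
have sfF i := smooth_fieldZ (sf i) (sF i).
pose S r q := \sum_(i <- r) f i q *: F i q.
suff [_ ->] : smooth_field (S (index_enum I)) p /\
  koszul_form B X Y (S (index_enum I)) p = \sum_i f i p * koszul_form B X Y (F i) p by [].
elim: (index_enum I) => [|i r [sr IH]].
  have E0 : \forall q \near p, (fun=> 0) q = S [::] q by near=> q; rewrite /S big_nil.
  split; first exact: eq_smooth_field E0 (smooth_field0 A p).
  have EE : \forall q \near p, S [::] q = (fun=> 0 : R[i]) q *: (fun=> 0 : cvec R) q.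
    by near=> q; rewrite /S big_nil scale0r.
  rewrite big_nil (@eq_koszul B X X Y Y _ _ p _ _ EE); try by near=> q.
  rewrite koszulZ_scale//; first exact: mul0r.
    exact: smooth_at_cst.
  exact: smooth_field0.
have Ei : \forall q \near p, f i q *: F i q + S r q = S (i :: r) q.
  by near=> q; rewrite /S big_cons.
split; first exact: eq_smooth_field Ei (smooth_fieldD (sfF i) sr).
rewrite big_cons -IH -(@eq_koszul B X X Y Y _ _ p _ _ Ei); try by near=> q.
by rewrite koszulZ_add// koszulZ_scale.
Unshelve. all: by end_near. Qed.

(** At [p] the Koszul expression is a bilinear form in the values [X p] and [Z p], whereas [Y] is
    differentiated; this is the matrix of that form in the coordinate frame of [p]. *)
Definition koszul_mx B Y p : 'M[R[i]]_4 := \matrix_(i, k)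
  koszul_form B (coord_field (chart_at A p) i) Y (coord_field (chart_at A p) k) p.

Lemma koszul_mxE B X Y Z p : smooth_field X p -> smooth_field Y p -> smooth_field Z p ->
  koszul_form B X Y Z p = (X p *m koszul_mx B Y p *m (Z p)^T) 0 0.
Proof.
move=> sX sY sZ; set a := chart_at A p; have ap : chart_dom a p := chart_atP A p.
have sE k : smooth_field (coord_field a k) p by exact: smooth_coord_field.
have sc V k : smooth_field V p -> smooth_at A (component V a k) p.
  exact: smooth_component.
have EV V : \forall q \near p, V q = \sum_(k < 4) component V a k q *: coord_field a k q.
  by apply: filterS (near_chart_dom ap) => q aq; exact: coord_field_sum.
rewrite (@eq_koszul B X _ Y Y Z _ p (EV X) _ (EV Z)); last by near=> q.
have sZ' : smooth_field (fun q => \sum_(k < 4) component Z a k q *: coord_field a k q) p.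
  by apply: smooth_field_sum => k; apply: smooth_fieldZ => //; exact: sc.
have sX' k : smooth_at A (component X a k) p by exact: sc.
rewrite (koszulX_sum B sX' sE sY sZ').
rewrite mxE; under [RHS]eq_bigr => k _ do rewrite mxE mulr_suml.
rewrite [RHS]exchange_big/=; apply: eq_bigr => i _.
have sZ'' k : smooth_at A (component Z a k) p by exact: sc.
rewrite (koszulZ_sum B sZ'' sE (sE i) sY).
rewrite mulr_sumr; apply: eq_bigr => k _.
by rewrite !component_at [koszul_mx _ _ _ _ _]mxE [_^T _ _]mxE -mulrA (mulrC (Z p 0 k)).
Unshelve. all: by end_near. Qed.

Lemma metric_unitmx p : g p \in unitmx.
Proof.
rewrite -row_free_unit; apply: inj_row_free => v vg.
apply: (@metric_nondegenerate p) => w.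
by rewrite /pairing vg mul0mx mxE.
Qed.

Lemma metric_inj p u w :
  (forall Z, smooth_field Z p -> pairing g p u (Z p) = pairing g p w (Z p)) -> u = w.
Proof.
move=> uw; apply/eqP; rewrite -subr_eq0; apply/eqP.
apply: (@metric_nondegenerate p) => v; rewrite pairingDl pairingNl.
have := uw _ (smooth_extend_vector A p v); rewrite extend_vector_at => ->.
exact: subrr.
Qed.

(** The solution [w] of [2 g(w, Z) = K_B(v, Y, Z)] for all [Z], that is, of the row equation
    [2 w g = v K] with [K] the Koszul matrix. *)
Definition weyl_nabla B : covariant_derivative R M :=
  fun Y p v => 2^-1 *: (v *m koszul_mx B Y p *m invmx (g p)).

Lemma pairing_weyl_nabla B X Y Z p :
  smooth_field X p -> smooth_field Y p -> smooth_field Z p ->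
  pairing g p (weyl_nabla B Y p (X p)) (Z p) = 2^-1 * koszul_form B X Y Z p.
Proof.
move=> sX sY sZ; rewrite (koszul_mxE B sX sY sZ) pairingZl /pairing.
by rewrite mulmxKV// metric_unitmx.
Qed.

Lemma pairing_weyl_nabla_vector B v Y Z p : smooth_field Y p -> smooth_field Z p ->
  pairing g p (weyl_nabla B Y p v) (Z p) = 2^-1 * koszul_form B (extend_vector A p v) Y Z p.
Proof.
move=> sY sZ; rewrite -(pairing_weyl_nabla _ (smooth_extend_vector A p v) sY sZ).
by rewrite extend_vector_at.
Qed.

(** The entries of [g] refer to the jumping charts [chart_at] and need not be smooth functions. The
    Gram matrix [G] of a fixed coordinate frame is smooth, and inverting it recovers the components
    of [W] from the pairings. *)
Lemma smooth_field_of_pairing W (h : 'I_4 -> M -> R[i]) p :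
  (forall k, smooth_at A (h k) p) ->
  (forall k, \forall q \near p,
     pairing g q (W q) (coord_field (chart_at A p) k q) = h k q) ->
  smooth_field W p.
Proof.
set a := chart_at A p => sh Wh; have ap : chart_dom a p := chart_atP A p.
pose G q : 'M[R[i]]_4 :=
  \matrix_(k, l) pairing g q (coord_field a k q) (coord_field a l q).
have sG k l : smooth_at A (fun q => G q k l) p.
  have sE m : smooth_field (coord_field a m) p by exact: smooth_coord_field.
  by apply: eq_smooth_at (sg (sE k) (sE l)); near=> q; rewrite mxE.
have uG : \forall q \near p, G q \in unitmx.
  apply: filterS (near_chart_dom ap) => q aq; set T := transition_jacobian a (chart_at A q) q.
  have uT : T \in unitmx.
    have TT : T *m transition_jacobian (chart_at A q) a q = 1%:M.
      rewrite -(transition_jacobian_cocycle (chart_atP A q) aq aq).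
      exact: transition_jacobian_id.
    exact: (mulmx1_unit TT).1.
  have -> : G q = T *m g q *m T^T.
    apply/matrixP => k l; rewrite [LHS]mxE /pairing /coord_field -row_mul [LHS]mxE.
    by rewrite [RHS]mxE; apply: eq_bigr => m _; rewrite ![_^T _ _]mxE ![row _ _ _ _]mxE.
  by rewrite !unitmx_mul unitmx_tr uT metric_unitmx.
move=> j.
pose F q := \sum_(k < 4) h k q * invmx (G q) k j.
have sF : smooth_at A F p.
  apply: smooth_at_sum => k; apply: smooth_atM; first exact: sh.
  exact: smooth_at_invmx.
apply: eq_smooth_at sF.
have Wh' : \forall q \near p, forall k, pairing g q (W q) (coord_field a k q) = h k q.
  by near=> q => k; move: k; near: q; exact: filter_forall.
apply: filterS3 uG Wh' (near_chart_dom ap) => q uq Wq aq.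
have -> : component W a j q = (\row_k component W a k q) 0 j by rewrite mxE.
rewrite -(mulmxK uq (\row_k _)) mxE; apply: eq_bigr => k _; congr (_ * _).
rewrite -Wq (coord_field_sum W aq) pairing_suml mxE.
by apply: eq_bigr => l _; rewrite pairingZl !mxE.
Unshelve. all: by end_near. Qed.

Lemma smooth_koszul B X Y Z p : is_oneform A B ->
  smooth_field X p -> smooth_field Y p -> smooth_field Z p ->
  smooth_at A (koszul_form B X Y Z) p.
Proof.
move=> sB sX sY sZ; have sL := smooth_lie_bracket.
do !(apply: smooth_atD || apply: smooth_atN || apply: smooth_atM);
  try apply: smooth_deriv_along => //; try exact: sB; apply: sg => //; exact: sL.
Qed.

Lemma weyl_nabla_connection B : is_oneform A B -> is_linear_connection A (weyl_nabla B).
Proof.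
move=> sB; split=> [p Y v _ _|p Y k u v [sY _] _ _|p Y Z v [sY _] [sZ _] _|
  p f Y v sf [sY _] _|p X Y [sX _] [sY _]].
- exact: memvf.
- by rewrite /weyl_nabla !mulmxDl -!scalemxAl scalerDr !scalerA mulrC.
- have sV := smooth_extend_vector A p v.
  apply: (@metric_inj p) => W sW; rewrite [RHS]pairingDl.
  apply: etrans (pairing_weyl_nabla_vector B v (smooth_fieldD sY sZ) sW) _.
  apply: etrans _ (esym (congr2 +%R (pairing_weyl_nabla_vector B v sY sW)
                                    (pairing_weyl_nabla_vector B v sZ sW))).
  by rewrite koszulY_add// mulrDr.
- have sV := smooth_extend_vector A p v.
  apply: (@metric_inj p) => W sW; expand_linear.
  apply: etrans (pairing_weyl_nabla_vector B v (smooth_fieldZ sf sY) sW) _.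
  rewrite (pairing_weyl_nabla_vector B v sY sW).
  rewrite (koszulY_scale B sf sV sY sW) extend_vector_at mulrDr -mulrA mulKf//.
  by rewrite addrC [2^-1 * _]mulrCA.
- apply: (@smooth_field_of_pairing _
    (fun k q => 2^-1 * koszul_form B X Y (coord_field (chart_at A p) k) q)) => k.
    apply: smooth_atM; first exact: smooth_at_cst.
    apply: smooth_koszul => //; exact/smooth_coord_field/chart_atP.
  apply: filterS3 (near_chart_dom (chart_atP A p)) (smooth_field_near sX)
    (smooth_field_near sY) => q aq sXq sYq.
  exact: (pairing_weyl_nabla B sXq sYq (smooth_coord_field k aq)).
Qed.

Lemma weyl_nabla_weyl B : is_oneform A B -> is_weyl A g (weyl_nabla B) B.
Proof.
move=> sB; split=> //; first exact: weyl_nabla_connection.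
  move=> p X Y sX sY; apply: (@metric_inj p) => Z sZ; rewrite [LHS]pairingDl pairingNl.
  transitivity (2^-1 * koszul_form B X Y Z p - 2^-1 * koszul_form B Y X Z p).
    exact: (congr2 (fun a b : R[i] => a - b) (pairing_weyl_nabla B sX sY sZ)
                                      (pairing_weyl_nabla B sY sX sZ)).
  by rewrite (koszul_torsion B X Y) mulrDr mulKf// addrC addrA addNr add0r.
move=> p v X Y sX sY; have sV := smooth_extend_vector A p v.
rewrite /covd_metric (gC p (X p)).
set d := deriv_along A p v _.
transitivity (d - 2^-1 * koszul_form B (extend_vector A p v) X Y p
                - 2^-1 * koszul_form B (extend_vector A p v) Y X p).
  exact: (congr2 (fun a b : R[i] => d - a - b) (pairing_weyl_nabla_vector B v sX sY)
                                        (pairing_weyl_nabla_vector B v sY sX)).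
rewrite (koszul_metric B _ X Y) extend_vector_at -/d.
generalize (koszul_form B (extend_vector A p v) X Y p) => k.
rewrite [2^-1 * (_ - _)]mulrBr mulKf//.
by ring_atoms.
Qed.

(** The uniqueness half of the Koszul argument: the metric condition is solved for the three
    derivatives of pairings, the brackets are replaced through zero torsion, and all terms but one
    cancel. *)
Lemma pairing_weyl nabla B X Y Z p : is_weyl A g nabla B ->
  smooth_field X p -> smooth_field Y p -> smooth_field Z p ->
  2 * pairing g p (nabla Y p (X p)) (Z p) = koszul_form B X Y Z p.
Proof.
move=> [_ tors _ metr] sX sY sZ; rewrite /koszul_form.
rewrite -!tors//.
have m U V W : smooth_field U p -> smooth_field V p -> smooth_field W p ->
   D p (U p) (fun q => pairing g q (V q) (W q)) =
   pairing g p (nabla V p (U p)) (W p) + pairing g p (nabla W p (U p)) (V p)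
   - form_eval B p (U p) * pairing g p (V p) (W p).
  move=> sU sV sW; have := metr p (U p) V W sV sW; rewrite /covd_metric.
  rewrite (gC p (V p) (nabla W p (U p))) => /(canRL (subrK _))/(canRL (subrK _)) ->.
  by ring_atoms.
rewrite (m _ _ _ sX sY sZ) (m _ _ _ sY sX sZ) (m _ _ _ sZ sX sY).
expand_linear.
by ring_atoms.
Qed.

End koszul_form.

(** * Partitions of unity *)

Section partition.
Variables (R : realType) (M : topologicalType) (A : manifold4 R M).
Implicit Types (p q : M) (X : M -> cvec R) (B : M -> 'cV[R[i]]_4).

Lemma manifold_bump p (U : set M) : nbhs p U -> exists f : M -> R[i],
  [/\ smooth A f, \forall q \near p, f q = 1 &
      forall q, U q \/ \forall r \near q, f r = 0].
Proof.
set a := chart_at A p => nU; have ap : chart_dom a p := chart_atP A p.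
have nV : nbhs (chart a p) [set x | chart_cod a x /\ U (chartV a x)].
  exact: filterS2 (near_chart_cod ap) (near_chartV ap nU).
have [b [K [sb b1 cK KV bK]]] := bump_exists nV.
pose f q : R[i] := if `[< chart_dom a q >] then real_complex R (b (chart a q)) else 0.
have fE q : chart_dom a q -> f q = real_complex R (b (chart a q)).
  by move=> aq; rewrite /f ifT//; apply/asboolP.
(* This uses that [M] is Hausdorff. It makes [f] vanish near every point outside the image of [K],
   in particular near each point outside the chart domain, so that the extension by zero is
   smooth. *)
have clK : closed (chartV a @` K).
  apply: compact_closed; first exact: manifold_hausdorff A.
  apply: continuous_compact => //; apply: continuous_in_subspaceT => x.
  by rewrite inE => /KV[ax _]; exact: chartV_continuous.
have f0 q : ~ (chartV a @` K) q -> \forall r \near q, f r = 0.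
  move=> nq; have oK : open (~` (chartV a @` K)) by exact: closed_openC.
  apply: filterS (open_nbhs_nbhs (conj oK nq)) => r nr.
  rewrite /f; case: ifPn => // /asboolP ar; rewrite bK// => Kr; apply: nr.
  by exists (chart a r) => //; rewrite chartK.
exists f; split.
- move=> q; have [aq|naq] := pselect (chart_dom a q).
    apply: (smooth_in_at aq); exists (chart_cod a); split=> //.
    + exact: chart_cod_open.
    + exact: chartP.
    + apply: (@eq_csmooth _ _ (fun x => real_complex R (b x))) => //.
      * exact: chart_cod_open.
      * by move=> x; rewrite inE => ax; rewrite fE ?chartVK//; exact: chartVP.
      * by split=> k; [exact: Ck_sub (sb k)|exact: Ck_cst].
  apply: (eq_smooth_at _ (smooth_at_cst A 0 q)); apply: filterS (f0 q _) => //.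
  by move=> [x /KV[ax _] xq]; apply: naq; rewrite -xq; exact: chartVP.
- apply: filterS2 (near_chart_dom ap) (near_chart ap b1) => q aq bq.
  by rewrite fE// bq.
- move=> q; have [[x /KV[_ Ux] <-]|/f0] := pselect ((chartV a @` K) q); first by left.
  by right.
Qed.

Definition oneform_at B p := forall X, smooth_field_at A X p ->
  smooth_at A (fun q => form_eval B q (X q)) p.

Lemma oneform_atD B C p : oneform_at B p -> oneform_at C p ->
  oneform_at (fun q => B q + C q) p.
Proof.
move=> sB sC X sX; apply: eq_smooth_at (smooth_atD (sB X sX) (sC X sX)).
by near=> q; rewrite /form_eval mulmxDr [RHS]mxE.
Unshelve. all: by end_near. Qed.

Lemma oneform_atZ (f : M -> R[i]) B p : smooth_at A f p -> oneform_at B p ->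
  oneform_at (fun q => f q *: B q) p.
Proof.
move=> sf sB X sX; apply: eq_smooth_at (smooth_atM sf (sB X sX)).
by near=> q; rewrite /form_eval -scalemxAr [RHS]mxE.
Unshelve. all: by end_near. Qed.

Lemma eq_oneform_at B C p : (\forall q \near p, B q = C q) ->
  oneform_at B p -> oneform_at C p.
Proof.
move=> BC sB X sX; apply: eq_smooth_at (sB X sX).
by apply: filterS BC => q BCq; rewrite /form_eval BCq.
Qed.

Lemma oneform_at0 p : oneform_at (fun=> 0) p.
Proof.
move=> X _; apply: eq_smooth_at (smooth_at_cst A 0 p).
by near=> q; rewrite /form_eval mulmx0 mxE.
Unshelve. all: by end_near. Qed.

Section glue.
Variables (f : nat -> M -> R[i]) (B : nat -> M -> 'cV[R[i]]_4).

(* [\sum_n f_n \prod_(m < n) (1 - f_m) B_n]: all terms after the first [n] with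
   [f_n = 1] vanish, which gives a partition of unity without paracompactness. *)
Fixpoint glue (n k : nat) p : 'cV[R[i]]_4 :=
  if k is k'.+1 then f n p *: B n p + (1 - f n p) *: glue n.+1 k' p else 0.

(** At index [m] the factor [1 - f m p] cuts off the rest, so every truncation that reaches [m]
    gives the same value. This allows the truncation length to vary with the point. *)
Lemma glue_stable m n k k' p : f m p = 1 -> (n <= m < n + k)%N -> (n <= m < n + k')%N ->
  glue n k p = glue n k' p.
Proof.
move=> fm; elim: k n k' => [|k IH] n k'; first by rewrite addn0; case: leqP.
case: k' => [|k']; first by rewrite addn0; case: (leqP n).
rewrite !addnS -!addSn /= => /andP[nm mk] /andP[_ mk'].
have [/eqP nmE|nmN] := boolP (n == m).
  by rewrite nmE fm subrr !scale0r.
rewrite (IH _ k')//; apply/andP; split => //; by rewrite ltn_neqAle nmN.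
Qed.

Lemma glue_oneform p n k : (forall n, smooth_at A (f n) p) ->
  (forall n, oneform_at (B n) p \/ \forall q \near p, f n q = 0) ->
  oneform_at (glue n k) p.
Proof.
move=> sf sB; elim: k n => [|k IH] n; first exact: oneform_at0.
apply: (@oneform_atD (fun q => f n q *: B n q) (fun q => (1 - f n q) *: glue n.+1 k q));
  last first.
  by apply: oneform_atZ (IH _); apply: smooth_atB => //; exact: smooth_at_cst.
have [sBn|f0] := sB n; first exact: oneform_atZ.
refine (@eq_oneform_at (fun=> 0) _ p _ (@oneform_at0 p)).
by apply: filterS f0 => q ->; rewrite scale0r.
Qed.

(** Each stage combines two values of [P] with weights of sum 1, or skips a [B n p] of weight 0 that
    may fail [P]. The terminal default 0, which may fail [P] as well, is removed by the weight
    [1 - f m p = 0]. *)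
Lemma glue_affine (P : set 'cV[R[i]]_4) p m n k :
  (forall b c t, P b -> P c -> P (t *: b + (1 - t) *: c)) ->
  (forall n, P (B n p) \/ f n p = 0) -> f m p = 1 -> (n <= m < n + k)%N ->
  P (glue n k p).
Proof.
move=> aff PB fm; elim: k n => [|k IH] n; first by rewrite addn0; case: leqP.
rewrite addnS -addSn /= => /andP[nm mk].
have [/eqP nmE|nmN] := boolP (n == m).
  rewrite nmE fm subrr scale0r addr0 scale1r.
  by have [//|fm0] := PB m; move: fm; rewrite fm0 => /esym/eqP; rewrite oner_eq0.
have IHn : P (glue n.+1 k p) by apply: IH; apply/andP; split; rewrite // ltn_neqAle nmN.
have [PBn|->] := PB n; first exact: aff.
by rewrite scale0r add0r subr0 scale1r.
Qed.

End glue.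

Lemma glue_oneforms (P : M -> set 'cV[R[i]]_4) :
  (forall p b c t, P p b -> P p c -> P p (t *: b + (1 - t) *: c)) ->
  (forall p, exists B, \forall q \near p, P q (B q) /\ oneform_at B q) ->
  exists2 B, is_oneform A B & forall p, P p (B p).
Proof.
move=> aff loc.
have loc' p : exists fB : (M -> R[i]) * (M -> 'cV[R[i]]_4),
    [/\ smooth A fB.1, \forall q \near p, fB.1 q = 1 &
        forall q, P q (fB.2 q) /\ oneform_at fB.2 q \/ \forall r \near q, fB.1 r = 0].
  have [B nB] := loc p; have [f [sf f1 f0]] := manifold_bump nB.
  by exists (f, B).
have [F FP] := choice loc'.
have [Ba cBa [oBa bBa]] := manifold_second_countable A.
have [h hinj] := elimT (countable_injP _) cBa.
(* Second countability replaces the family of bumps indexed by points by a sequence: [n] codes a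
   basic open set on which the bump of [p] is 1. For each code one such point is chosen; another
   point with the same code has its basic set covered just as well. *)
pose Q n (p : M) := exists b : set M, [/\ Ba b, h b = n & b `<=` [set q | (F p).1 q = 1]].
have seqP n : exists fB : (M -> R[i]) * (M -> 'cV[R[i]]_4),
   [/\ smooth A fB.1, forall q, P q (fB.2 q) /\ oneform_at fB.2 q \/ \forall r \near q, fB.1 r = 0
     & forall p, Q n p -> exists2 p', Q n p' & fB = F p'].
  have [[p Qp]|nQ] := pselect (exists p, Q n p).
    by exists (F p); have [sf _ f0] := FP p; split=> // _ _; exists p.
  (* A code that serves no point receives weight 0, which contributes nothing to the sum. *)
  exists (fun=> 0, fun=> 0); split.
  - by move=> q; exact: smooth_at_cst.
  - by move=> q; right; exact: nearW.
  - by move=> p Qp; case: nQ; exists p.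
have [S SP] := choice seqP.
pose f n := (S n).1; pose B n := (S n).2.
have cover p : exists n, \forall q \near p, f n q = 1.
  have [_ Fp1 _] := FP p.
  have [b [/= Bab bp] bF] := bBa p _ Fp1.
  have Qp : Q (h b) p by exists b.
  have [_ _ /(_ p Qp)[p' [b' [Bab' hb' b'F]] E]] := SP (h b).
  have bb : b' = b by apply: hinj; rewrite ?inE.
  exists (h b); apply: filterS (open_nbhs_nbhs (conj (oBa _ Bab) bp)) => q bq.
  by rewrite /f E; apply: b'F; rewrite bb.
have [m mP] := choice cover.
have m1 p : f (m p) p = 1 by exact: nbhs_singleton (mP p).
exists (fun p => glue f B 0 (m p).+1 p).
  move=> p; apply: (@eq_oneform_at (glue f B 0 (m p).+1)).
    apply: filterS (mP p) => q fq.
    (* Near [p] both [f (m p)] and [f (m q)] equal 1 at [q]; the smaller of the two indices lies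
       within both truncations, so the locally constant length [(m p).+1] may be used. *)
    have [le|lt] := leqP (m p) (m q).
      by apply: (@glue_stable f B (m p) 0 _ _ q fq); rewrite /= add0n ltnS.
    by apply: (@glue_stable f B (m q) 0 _ _ q (m1 q)); rewrite /= add0n ltnS// ltnW.
  apply: glue_oneform => n; first by have [+ _ _] := SP n; apply.
  by have [_ /(_ p)[[_ ?]|?] _] := SP n; [left|right].
move=> p; apply: (@glue_affine f B (P p) p (m p) 0 _ (aff p) _ (m1 p)).
  move=> n; have [_ /(_ p)[[? _]|f0] _] := SP n; first by left.
  by right; exact: nbhs_singleton f0.
by rewrite /= add0n ltnS.
Qed.

End partition.

(** * Null planes *)

Section planes.
Variable K : fieldType.
Implicit Types (x y u : 'rV[K]_4) (g : 'M[K]_4).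

Lemma span2P x y u : reflect (exists a b, u = a *: x + b *: y) (u \in <<[:: x; y]>>%VS).
Proof.
rewrite span_cons span_seq1; apply: (iffP memv_addP).
  by move=> [v /vlineP[a ->] [w /vlineP[b ->] ->]]; exists a, b.
by move=> [a [b ->]]; exists (a *: x); rewrite ?memvZ ?memv_line//;
  exists (b *: y); rewrite ?memvZ ?memv_line.
Qed.

Lemma free2_row_free x y : free [:: x; y] -> row_free (col_mx x y).
Proof.
rewrite free_cons seq1_free span_seq1 => /andP[xy y0].
apply: inj_row_free => v; rewrite -[v]hsubmxK mul_row_col.
rewrite [lsubmx v]mx11_scalar [rsubmx v]mx11_scalar !mul_scalar_mx.
move: (lsubmx v 0 0) (rsubmx v 0 0) => a b E.
have a0 : a = 0.
  apply: contraNeq xy => a0; apply/vlineP; exists (- (a^-1 * b)).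
  rewrite scaleNr -scalerA; apply/eqP; rewrite -addr_eq0; apply/eqP.
  by rewrite -[x in x + _](scalerK a0) -scalerDr E scaler0.
move: E; rewrite a0 scale0r add0r => /eqP; rewrite scaler_eq0 (negbTE y0) orbF => /eqP ->.
by rewrite !raddf0 row_mx0.
Qed.

(** Dimension count: the orthogonal of the plane has rank 4 - 2 = 2 and contains the plane by
    nullity, hence equals it. *)
Lemma plane_orthogonal g x y u : g \in unitmx -> free [:: x; y] ->
  x *m g *m x^T = 0 -> x *m g *m y^T = 0 -> y *m g *m x^T = 0 -> y *m g *m y^T = 0 ->
  u *m g *m x^T = 0 -> u *m g *m y^T = 0 -> u \in <<[:: x; y]>>%VS.
Proof.
move=> ug fxy xx xy yx yy ux uy; have rN := free2_row_free fxy.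
set P := col_mx x y in rN.
have PgP : P *m (g *m P^T) = 0.
  rewrite mulmxA /P mul_col_mx tr_col_mx mul_col_mx !mul_mx_row xx xy yx yy.
  by rewrite !row_mx0 col_mx0.
have ugP : u *m (g *m P^T) = 0 by rewrite mulmxA /P tr_col_mx mul_mx_row ux uy row_mx0.
have rk : \rank (kermx (g *m P^T)) = 2%N.
  rewrite mxrank_ker -mxrank_tr trmx_mul trmxK.
  by rewrite mxrankMfree ?row_free_unit ?unitmx_tr// (eqP rN).
have sub : (P <= kermx (g *m P^T))%MS by apply/sub_kermxP.
have ker_sub : (kermx (g *m P^T) <= P)%MS.
  by rewrite -(mxrank_leqif_sup sub).2 rk (eqP rN).
have : (u <= P)%MS by apply: submx_trans ker_sub; apply/sub_kermxP.
move=> /submxP[D ->]; rewrite -[D]hsubmxK mul_row_col.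
rewrite [lsubmx D]mx11_scalar [rsubmx D]mx11_scalar !mul_scalar_mx.
by apply/span2P; exists (lsubmx D 0 0), (rsubmx D 0 0).
Qed.

(** The covectors [g(x, -)] and [g(y, -)] are independent, so the matrix they form has a right
    inverse, whose columns are [z] and [w]. *)
Lemma plane_dual g x y : g \in unitmx -> free [:: x; y] ->
  exists z w : 'rV[K]_4, [/\ x *m g *m z^T = 1%:M, x *m g *m w^T = 0,
    y *m g *m z^T = 0 & y *m g *m w^T = 1%:M].
Proof.
move=> ug fxy; have rN := free2_row_free fxy.
have : row_free (col_mx x y *m g) by rewrite /row_free mxrankMfree ?row_free_unit.
move=> /row_freeP[C]; rewrite -[C]hsubmxK mul_col_mx mul_col_mx !mul_mx_row.
rewrite -[col_mx _ _]/(block_mx _ _ _ _) scalar_mx_block => /eq_block_mx[xz xw yz yw].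
by exists (lsubmx C)^T, (rsubmx C)^T; rewrite !trmxK.
Qed.

End planes.

(** * Local frames of N with dual fields *)

Section frames.
Variables (R : realType) (M : topologicalType) (A : manifold4 R M).
Variables (g : M -> 'M[R[i]]_4) (hg : is_metric A g).
Variables (N : M -> {vspace cvec R}) (hN : is_distribution2 A N).
Hypotheses (hnull : totally_null g N) (hint : integrable A N).
Implicit Types (f : M -> R[i]) (p q : M) (X Y Z : M -> cvec R)
  (B : M -> 'cV[R[i]]_4) (b c : 'cV[R[i]]_4).
Notation smooth_field := (smooth_field_at A).
Notation section := (section_at A N).
Notation D := (deriv_along A).

Let gC p u v : pairing g p u v = pairing g p v u.
Proof. by case: hg => + _ _; apply. Qed.

Lemma smooth_at_neq0 f p : smooth_at A f p -> f p != 0 -> \forall q \near p, f q != 0.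
Proof.
move=> /smooth_atE sf fp; have ap := chart_atP A p.
have nf := near_chart ap (smooth_in_neq0 ap sf fp).
by apply: filterS2 (near_chart_dom ap) nf => q aq; rewrite /= chartK.
Qed.

(** The relations are required near [p], so that they can be differentiated and a frame at [p] is
    also a frame at nearby points. *)
Record frame_at X1 X2 Z1 Z2 p : Prop := Frame {
  frame_X1 : smooth_field X1 p; frame_X2 : smooth_field X2 p;
  frame_Z1 : smooth_field Z1 p; frame_Z2 : smooth_field Z2 p;
  frame_near : \forall q \near p,
    [/\ \dim (N q) = 2%N, N q = <<[:: X1 q; X2 q]>>%VS,
        pairing g q (Z1 q) (X1 q) = 1 /\ pairing g q (Z1 q) (X2 q) = 0 &
        pairing g q (Z2 q) (X1 q) = 0 /\ pairing g q (Z2 q) (X2 q) = 1]}.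

Lemma frame_near_at X1 X2 Z1 Z2 p : frame_at X1 X2 Z1 Z2 p ->
  \forall q \near p, frame_at X1 X2 Z1 Z2 q.
Proof.
case=> /smooth_field_near n1 /smooth_field_near n2 /smooth_field_near n3.
move=> /smooth_field_near n4 /nbhs_interior n5.
by near=> q; split; near: q.
Unshelve. all: by end_near. Qed.

Lemma span2_free (K : fieldType) (x y : 'rV[K]_4) :
  \dim <<[:: x; y]>>%VS = 2%N -> free [:: x; y].
Proof. by move=> d; rewrite /free d. Qed.

Lemma frame_exists p : exists X1 X2 Z1 Z2, frame_at X1 X2 Z1 Z2 p.
Proof.
have [X1 [X2 [s1 s2 nN]]] := hN p.
have [dN NE] := nbhs_singleton nN.
have fX : free [:: X1 p; X2 p] by apply: span2_free; rewrite -NE.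
have [z1 [z2 [g11 g12 g21 g22]]] := plane_dual (metric_unitmx hg p) fX.
pose Y1 := extend_vector A p z1; pose Y2 := extend_vector A p z2.
have sY1 : smooth_field Y1 p := smooth_extend_vector A p z1.
have sY2 : smooth_field Y2 p := smooth_extend_vector A p z2.
have sg X Y : smooth_field X p -> smooth_field Y p ->
  smooth_at A (fun q => pairing g q (X q) (Y q)) p by case: hg => _ _; apply.
pose a q := pairing g q (Y1 q) (X1 q); pose b q := pairing g q (Y1 q) (X2 q).
pose c q := pairing g q (Y2 q) (X1 q); pose d q := pairing g q (Y2 q) (X2 q).
have [sa sb sc sd] : [/\ smooth_at A a p, smooth_at A b p, smooth_at A c p & smooth_at A d p].
  by split; exact: sg.
pose e q := a q * d q - b q * c q.
have se : smooth_at A e p by apply: smooth_atB; exact: smooth_atM.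
have e1 : e p = 1.
  rewrite /e /a /b /c /d /Y1 /Y2 !extend_vector_at !(gC p z1) !(gC p z2).
  by rewrite /pairing g11 g12 g21 g22 !mxE eqxx mulr1 mulr0 subr0.
have e0 : e p != 0 by rewrite e1 oner_eq0.
have seV : smooth_at A (fun q => (e q)^-1) p by exact: smooth_atV.
(* The extensions [Y1], [Y2] are dual to the frame only at [p]; Cramer's rule for the 2 by 2 matrix
   of pairings, of determinant [e] with [e p = 1], corrects them nearby. *)
pose Z1 q := (e q)^-1 *: (d q *: Y1 q + - b q *: Y2 q).
pose Z2 q := (e q)^-1 *: (a q *: Y2 q + - c q *: Y1 q).
exists X1, X2, Z1, Z2; split=> //.
- apply: smooth_fieldZ => //.
  by apply: smooth_fieldD; apply: smooth_fieldZ => //; exact: smooth_atN.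
- apply: smooth_fieldZ => //.
  by apply: smooth_fieldD; apply: smooth_fieldZ => //; exact: smooth_atN.
apply: filterS2 nN (smooth_at_neq0 se e0) => q [dq Nq] eq0.
have E1 w : pairing g q (Z1 q) w =
    (e q)^-1 * (d q * pairing g q (Y1 q) w - b q * pairing g q (Y2 q) w).
  by rewrite /Z1 pairingZl pairingDl !pairingZl mulNr.
have E2 w : pairing g q (Z2 q) w =
    (e q)^-1 * (a q * pairing g q (Y2 q) w - c q * pairing g q (Y1 q) w).
  by rewrite /Z2 pairingZl pairingDl !pairingZl mulNr.
split; [exact: dq|exact: Nq|split|split].
- by apply: (etrans (E1 (X1 q))); rewrite -/(a q) -/(c q) [d q * _]mulrC mulVf.
- by apply: (etrans (E1 (X2 q))); rewrite -/(b q) -/(d q) [d q * _]mulrC subrr mulr0.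
- by apply: (etrans (E2 (X1 q))); rewrite -/(a q) -/(c q) [a q * _]mulrC subrr mulr0.
- by apply: (etrans (E2 (X2 q))); rewrite -/(b q) -/(d q) [c q * _]mulrC mulVf.
Qed.

End frames.

(** * The 1-forms whose Weyl connections preserve N *)

Section preserving.
Variables (R : realType) (M : topologicalType) (A : manifold4 R M).
Variables (g : M -> 'M[R[i]]_4) (hg : is_metric A g).
Variables (N : M -> {vspace cvec R}) (hN : is_distribution2 A N).
Hypotheses (hnull : totally_null g N) (hint : integrable A N).
Implicit Types (f : M -> R[i]) (p q : M) (X Y Z : M -> cvec R)
  (B : M -> 'cV[R[i]]_4) (b c : 'cV[R[i]]_4).
Notation smooth_field := (smooth_field_at A).
Notation section := (section_at A N).
Notation D := (deriv_along A).
Notation koszul := (koszul_form A g).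
Notation frame_at := (frame_at A g N).

Let gC p u v : pairing g p u v = pairing g p v u.
Proof. by case: hg => + _ _; apply. Qed.

Let sg p X Y : smooth_field X p -> smooth_field Y p ->
  smooth_at A (fun q => pairing g q (X q) (Y q)) p.
Proof. by case: hg => _ _; apply. Qed.

Lemma section_at_mem X p : section X p -> X p \in N p.
Proof. by move=> [_ /nbhs_singleton]. Qed.

Lemma section_null X Y p : section X p -> section Y p -> pairing g p (X p) (Y p) = 0.
Proof. by move=> sX sY; apply: hnull; exact: section_at_mem. Qed.

Lemma deriv_section_null v X Y p : section X p -> section Y p ->
  D p v (fun q => pairing g q (X q) (Y q)) = 0.
Proof.
move=> [_ nX] [_ nY]; rewrite -(deriv_along_cst A p v 0); apply: eq_deriv_along.
by apply: filterS2 nX nY => q; exact: hnull.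
Qed.

(** Pairings of sections vanish identically, hence so do their derivatives and the terms in [B]; the
    brackets lie in N by integrability, so their pairings with sections vanish too. *)
Lemma koszul_sections B X Y Z p : section X p -> section Y p -> section Z p ->
  koszul B X Y Z p = 0.
Proof.
move=> sX sY sZ; rewrite /koszul_form.
have br U V W : section U p -> section V p -> section W p ->
    pairing g p (lie_bracket A U V p) (W p) = 0.
  by move=> sU sV sW; apply: hnull; [exact: hint|exact: section_at_mem].
subst_atom (br _ _ _ sX sY sZ); subst_atom (br _ _ _ sX sZ sY).
subst_atom (br _ _ _ sY sZ sX).
subst_atom (deriv_section_null (X p) sY sZ); subst_atom (deriv_section_null (Y p) sX sZ).
subst_atom (deriv_section_null (Z p) sX sY).
subst_atom (section_null sY sZ); subst_atom (section_null sX sZ).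
subst_atom (section_null sX sY).
by ring_atoms.
Qed.

Lemma koszul_sectionC B X Y Z p : section Y p -> section Z p ->
  koszul B X Z Y p = - koszul B X Y Z p.
Proof.
move=> sY sZ; rewrite (koszul_metric hg B X Y Z) (section_null sY sZ).
by rewrite (deriv_section_null _ sY sZ) mulr0 addr0 mulr0 add0r.
Qed.

Lemma koszul_section_form B X Y Z p : section Y p -> section Z p ->
  koszul B X Y Z p = koszul (fun=> 0) X Y Z p
    + form_eval B p (Y p) * pairing g p (X p) (Z p)
    - form_eval B p (Z p) * pairing g p (X p) (Y p).
Proof.
move=> sY sZ; rewrite /koszul_form; subst_atom (section_null sY sZ).
have E0 v : form_eval (fun=> 0) p v = 0 :> R[i] by rewrite /form_eval mulmx0 mxE.
subst_atom (E0 (X p)); subst_atom (E0 (Y p)); subst_atom (E0 (Z p)).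
by ring_atoms.
Qed.

Lemma koszul_section_diag B X Y p : section Y p -> koszul B X Y Y p = 0.
Proof.
move=> sY; have E := koszul_sectionC B X sY sY.
have /eqP : 2 * koszul B X Y Y p = 0 by rewrite mulr_natl mulr2n {1}E addNr.
by rewrite mulf_eq0 pnatr_eq0 => /eqP.
Qed.

Lemma frame_sections X1 X2 Z1 Z2 p : frame_at X1 X2 Z1 Z2 p ->
  section X1 p /\ section X2 p.
Proof.
case=> s1 s2 _ _ n; split; split=> //; apply: filterS n => q [_ -> _ _];
  by apply: memv_span; rewrite !inE eqxx ?orbT.
Qed.

Lemma frame_orthogonal X1 X2 Z1 Z2 q u : frame_at X1 X2 Z1 Z2 q ->
  pairing g q u (X1 q) = 0 -> pairing g q u (X2 q) = 0 -> u \in N q.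
Proof.
move=> fq; have [sX1 sX2] := frame_sections fq.
have [dq NE _ _] := nbhs_singleton (frame_near fq).
have fX : free [:: X1 q; X2 q] by apply: span2_free; rewrite -NE.
have mx0 v w : pairing g q v w = 0 -> v *m g q *m w^T = 0.
  by move=> vw; rewrite [LHS]mx11_scalar -/(pairing g q v w) vw raddf0.
move=> /mx0 u1 /mx0 u2; rewrite NE.
exact: (plane_orthogonal (metric_unitmx hg q) fX
  (mx0 _ _ (section_null sX1 sX1)) (mx0 _ _ (section_null sX1 sX2))
  (mx0 _ _ (section_null sX2 sX1)) (mx0 _ _ (section_null sX2 sX2)) u1 u2).
Qed.

Lemma frame_expand X1 X2 Z1 Z2 Y p : frame_at X1 X2 Z1 Z2 p -> section Y p ->
  \forall q \near p, pairing g q (Z1 q) (Y q) *: X1 q + pairing g q (Z2 q) (Y q) *: X2 q = Y q.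
Proof.
move=> fp [_ nY]; apply: filterS2 (frame_near fp) nY => q [_ -> [z11 z12] [z21 z22]].
move=> /span2P[a [b ->]]; rewrite !pairingDr !pairingZr z11 z12 z21 z22.
by rewrite !mulr1 !mulr0 addr0 add0r.
Qed.

(** Subtracting from [X] its part along [Z1], [Z2] leaves a field [W] orthogonal to [X1] and [X2],
    hence a section of N, on which the expression vanishes by [koszul_sections]. *)
Lemma koszul_frame B X1 X2 Z1 Z2 X p : frame_at X1 X2 Z1 Z2 p -> smooth_field X p ->
  koszul B X X1 X2 p = pairing g p (X1 p) (X p) * koszul B Z1 X1 X2 p
                       + pairing g p (X2 p) (X p) * koszul B Z2 X1 X2 p.
Proof.
move=> fp sX; have [sec1 sec2] := frame_sections fp; have [s1 s2 sZ1 sZ2 n] := fp.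
pose a q := pairing g q (X1 q) (X q); pose b q := pairing g q (X2 q) (X q).
have [sa sb] : smooth_at A a p /\ smooth_at A b p by split; exact: sg.
pose Y1 q := a q *: Z1 q; pose Y2 q := b q *: Z2 q.
have sY1 : smooth_field Y1 p by exact: smooth_fieldZ.
have sY2 : smooth_field Y2 p by exact: smooth_fieldZ.
have sY : smooth_field (fun q => Y1 q + Y2 q) p by exact: smooth_fieldD.
pose W q := X q + (-1) *: (Y1 q + Y2 q).
have sW : section W p.
  split; first exact: smooth_fieldD sX (smooth_fieldZ (smooth_at_cst A (-1) p) sY).
  apply: filterS2 (frame_near_at fp) n => q fq [_ _ [z11 z12] [z21 z22]].
  apply: (frame_orthogonal fq); rewrite /W /Y1 /Y2; expand_linear.
    by rewrite z11 z21 mulr1 mulr0 addr0 mulN1r /a gC subrr.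
  by rewrite z12 z22 mulr1 mulr0 add0r mulN1r /b gC subrr.
have EX : \forall q \near p, X q = W q + (Y1 q + Y2 q).
  by apply: nearW => q; rewrite /W scaleN1r subrK.
rewrite (@eq_koszul _ _ A g B X _ X1 X1 X2 X2 p EX); try exact: nearW.
apply: (etrans (koszulX_add hg B sW.1 sY s1 s2)).
apply: (etrans (congr2 +%R (koszul_sections B sW sec1 sec2)
                           (koszulX_add hg B sY1 sY2 s1 s2))).
apply: (etrans (add0r _)).
exact: (congr2 +%R (koszulX_scale hg B sa sZ1 s1 s2) (koszulX_scale hg B sb sZ2 s1 s2)).
Qed.

(* [b] is admissible as the value at [p] of the 1-form of a Weyl connection
   preserving [N]; this is an affine condition on [b]. *)
Definition preserving p b := forall X Y Z, smooth_field X p -> section Y p -> section Z p ->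
  koszul (fun=> b) X Y Z p = 0.

(** A skew bilinear form on a plane is determined by its value on one basis. The expression is
    indeed bilinear on sections: the Leibniz term in the slot [Y] carries a factor [g(X1, Z)] or
    [g(X2, Z)], which is zero. *)
Lemma preserving_frame X1 X2 Z1 Z2 p b : frame_at X1 X2 Z1 Z2 p ->
  (forall X, smooth_field X p -> koszul (fun=> b) X X1 X2 p = 0) -> preserving p b.
Proof.
move=> fp H; have [sec1 sec2] := frame_sections fp; have [s1 s2 sZ1 sZ2 n] := fp.
have lin X Y Z : smooth_field X p -> section Y p -> section Z p ->
    koszul (fun=> b) X X1 Z p = 0 -> koszul (fun=> b) X X2 Z p = 0 ->
    koszul (fun=> b) X Y Z p = 0.
  move=> sX sY sZ k1 k2; have EY := frame_expand fp sY.
  have [sY' sZ'] := (sY.1, sZ.1).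
  have sa : smooth_at A (fun q => pairing g q (Z1 q) (Y q)) p by exact: sg.
  have sb : smooth_at A (fun q => pairing g q (Z2 q) (Y q)) p by exact: sg.
  have sf1 := smooth_fieldZ sa s1; have sf2 := smooth_fieldZ sb s2.
  rewrite -(@eq_koszul _ _ A g _ X X _ _ Z Z p _ EY); try exact: nearW.
  rewrite (koszulY_add hg _ sX sf1 sf2 sZ').
  rewrite (koszulY_scale hg _ sa sX s1 sZ') (koszulY_scale hg _ sb sX s2 sZ').
  subst_atom k1; subst_atom k2.
  subst_atom (section_null sec1 sZ); subst_atom (section_null sec2 sZ).
  by ring_atoms.
have opp X Y Z : section Y p -> section Z p ->
    koszul (fun=> b) X Y Z p = 0 -> koszul (fun=> b) X Z Y p = 0.
  move=> sY sZ k; apply: (etrans (koszul_sectionC _ _ sY sZ)).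
  by subst_atom k; rewrite oppr0.
move=> X Y Z sX sY sZ; apply: (lin _ _ _ sX sY sZ); apply: (opp _ _ _) => //.
  apply: (lin _ _ _ sX sZ sec1); first exact: koszul_section_diag.
  exact: (opp _ _ _ sec1 sec2 (H X sX)).
by apply: (lin _ _ _ sX sZ sec2); [exact: H|exact: koszul_section_diag].
Qed.

Lemma form_eval_const B p v : form_eval (fun=> B p) p v = form_eval B p v.
Proof. by []. Qed.

Lemma preserving_affine p b c (t : R[i]) :
  preserving p b -> preserving p c -> preserving p (t *: b + (1 - t) *: c).
Proof.
move=> pb pc X Y Z sX sY sZ.
have E v : form_eval (fun=> t *: b + (1 - t) *: c) p v =
    t * form_eval (fun=> b) p v + (1 - t) * form_eval (fun=> c) p v.
  by rewrite /form_eval mulmxDr -!scalemxAr [LHS]mxE; congr (_ + _); rewrite mxE.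
have -> : koszul (fun=> t *: b + (1 - t) *: c) X Y Z p =
    t * koszul (fun=> b) X Y Z p + (1 - t) * koszul (fun=> c) X Y Z p.
  rewrite /koszul_form; subst_atom (E (X p)); subst_atom (E (Y p)); subst_atom (E (Z p)).
  by ring_atoms.
by rewrite pb// pc// !mulr0 addr0.
Qed.

(* If [Z1], [Z2] are dual to a frame [X1], [X2] of [N], admissibility of [b] only
   prescribes its values on [X1] and [X2]; take a combination of [g(Z1, -)] and
   [g(Z2, -)]. *)
Lemma preserving_exists p : exists B,
  \forall q \near p, preserving q (B q) /\ oneform_at A B q.
Proof.
have [X1 [X2 [Z1 [Z2 fp]]]] := frame_exists hg hN p.
pose k1 q := koszul (fun=> 0) Z1 X1 X2 q; pose k2 q := koszul (fun=> 0) Z2 X1 X2 q.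
(* By [koszul_frame] and [koszul_section_form] the equation to solve is [g(X1, X) k1 + g(X2, X) k2 +
   B(X1) g(X, X2) - B(X2) g(X, X1) = 0], which asks for [B(X1) = - k2] and [B(X2) = k1]. *)
pose B q : 'cV[R[i]]_4 := k1 q *: (g q *m (Z2 q)^T) - k2 q *: (g q *m (Z1 q)^T).
have BE q v : form_eval (fun=> B q) q v = k1 q * pairing g q v (Z2 q) - k2 q * pairing g q v (Z1 q).
  rewrite /form_eval /B mulmxBr -!scalemxAr !mulmxA [LHS]mxE.
  by congr (_ + _); rewrite mxE// mxE.
exists B; apply: filterS (frame_near_at fp) => q fq.
have [s1 s2 sZ1 sZ2 n] := fq; have [sec1 sec2] := frame_sections fq; split.
  apply: (preserving_frame fq) => X sX.
  apply: (etrans (koszul_section_form _ X sec1 sec2)).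
  subst_atom (koszul_frame (fun=> 0) fq sX).
  have [_ _ [z11 z12] [z21 z22]] := nbhs_singleton n.
  have B1 : form_eval (fun=> B q) q (X1 q) = - k2 q.
    apply: (etrans (BE q (X1 q))); subst_atom (gC q (X1 q) (Z1 q)).
    by subst_atom (gC q (X1 q) (Z2 q)); rewrite z11 z21 mulr0 mulr1 sub0r.
  have B2 : form_eval (fun=> B q) q (X2 q) = k1 q.
    apply: (etrans (BE q (X2 q))); subst_atom (gC q (X2 q) (Z1 q)).
    by subst_atom (gC q (X2 q) (Z2 q)); rewrite z12 z22 mulr0 mulr1 subr0.
  subst_atom B1; subst_atom B2; subst_atom (gC q (X1 q) (X q)).
  subst_atom (gC q (X2 q) (X q)); rewrite -/(k1 q) -/(k2 q).
  generalize (k1 q) (k2 q) => a b.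
  by ring_atoms.
move=> X sX.
have s0 : is_oneform A (fun=> 0 : 'cV[R[i]]_4) by move=> r; exact: oneform_at0.
apply: (@eq_smooth_at _ _ _ (fun q => k1 q * pairing g q (X q) (Z2 q)
                                    - k2 q * pairing g q (X q) (Z1 q))).
  apply: nearW => r; apply: (etrans (esym (BE r (X r)))).
  exact: (form_eval_const B r (X r)).
by apply: smooth_atB; apply: smooth_atM; [exact: smooth_koszul|exact: sg|
  exact: smooth_koszul|exact: sg].
Qed.

Lemma preserving_unique p b c v : preserving p b -> preserving p c -> v \in N p ->
  (v *m b) 0 0 = (v *m c) 0 0.
Proof.
move=> pb pc; have [X1 [X2 [Z1 [Z2 fp]]]] := frame_exists hg hN p.
have [s1 s2 sZ1 sZ2 n] := fp; have [sec1 sec2] := frame_sections fp.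
have [_ -> [z11 z12] [z21 z22]] := nbhs_singleton n.
have E X : smooth_field X p ->
    (form_eval (fun=> b) p (X1 p) - form_eval (fun=> c) p (X1 p)) * pairing g p (X p) (X2 p)
    = (form_eval (fun=> b) p (X2 p) - form_eval (fun=> c) p (X2 p)) * pairing g p (X p) (X1 p).
  move=> sX.
  have := etrans (esym (koszul_section_form _ X sec1 sec2)) (pb X X1 X2 sX sec1 sec2).
  have := etrans (esym (koszul_section_form _ X sec1 sec2)) (pc X X1 X2 sX sec1 sec2).
  generalize (koszul (fun=> 0) X X1 X2 p) => k /eqP; rewrite subr_eq0 => /eqP e1.
  move=> /eqP; rewrite subr_eq0 => /eqP e2.
  by rewrite !mulrBl -e1 -e2; ring_atoms.
(* By duality, testing on [Z2] isolates the values on [X1], and testing on [Z1] those on [X2]. *)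
have E1 := E Z2 sZ2; have E2 := E Z1 sZ1.
move: E1 E2; rewrite z11 z12 z21 z22 !mulr1 !mulr0.
move=> /eqP; rewrite subr_eq0 => /eqP e1 /esym/eqP; rewrite subr_eq0 => /eqP e2.
move=> /span2P[x [y ->]]; rewrite -!/(form_eval (fun=> _) p _).
by rewrite !form_evalD !form_evalZ e1 e2.
Qed.

Lemma weyl_preserving nabla B p : is_weyl A g nabla B -> preserves A N nabla ->
  preserving p (B p).
Proof.
move=> wB pN X Y Z sX sY sZ; have [sY' sZ'] := (sY.1, sZ.1).
have := pairing_weyl hg wB sX sY' sZ'.
rewrite (hnull (pN p Y (X p) sY) (section_at_mem sZ)) mulr0 => /esym E.
exact: E.
Qed.

(** Admissibility makes the derivative of a section orthogonal to [X1] and [X2], and the orthogonal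
    of N is N. *)
Lemma preserving_weyl_nabla B : (forall p, preserving p (B p)) ->
  preserves A N (weyl_nabla A g B).
Proof.
move=> pB p Y v sY; have [X1 [X2 [Z1 [Z2 fp]]]] := frame_exists hg hN p.
have [s1 s2 _ _ _] := fp; have [sec1 sec2] := frame_sections fp.
have sV := smooth_extend_vector A p v.
apply: (frame_orthogonal fp); rewrite (pairing_weyl_nabla_vector hg _ _ sY.1)//.
  (* The Koszul expression at [p] involves only the value [B p], so it is convertible with the one
     for the constant form used in [preserving]. *)
  by rewrite -[LHS]/(2^-1 * koszul (fun=> B p) _ _ _ _) pB// mulr0.
by rewrite -[LHS]/(2^-1 * koszul (fun=> B p) _ _ _ _) pB// mulr0.
Qed.

Lemma weyl_preserving_unique nabla nabla' B B' :
  is_weyl A g nabla B -> preserves A N nabla ->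
  is_weyl A g nabla' B' -> preserves A N nabla' -> eq_on A N nabla nabla'.
Proof.
move=> wB pN wB' pN' p Y v sY vN; have sV := smooth_extend_vector A p v.
have [sY' YN] := (sY.1, section_at_mem sY).
have U w : w \in N p -> form_eval B p w = form_eval B' p w.
  exact: preserving_unique (weyl_preserving wB pN) (weyl_preserving wB' pN').
apply: (@metric_inj _ _ A g hg p) => Z sZ.
have two0 : (2 : R[i]) != 0 by rewrite pnatr_eq0.
apply: (mulfI two0); rewrite -(extend_vector_at A p v).
rewrite (pairing_weyl hg wB sV sY' sZ) (pairing_weyl hg wB' sV sY' sZ).
(* The only value of the 1-form outside N is at [Z], and its coefficient [g(v, Y)] is 0; at [v] and
   [Y p] the two forms agree. *)
rewrite /koszul_form extend_vector_at; subst_atom (gC p v (Y p)); subst_atom (hnull YN vN).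
subst_atom (U v vN); subst_atom (U _ YN).
by ring_atoms.
Qed.

End preserving.

(** * Conformal changes *)

Section cexp_derivative.
Variable R : realType.
Notation E := 'rV[R]_4.
Notation e_ i := (delta_mx 0 i : E).
Implicit Types (F : E -> R[i]) (x : E).

Let dexp (t : R) : derivable expR t 1. Proof. exact: derivable_expR. Qed.
Let dcos (t : R) : derivable cos t 1. Proof. exact: derivable_cos. Qed.
Let dsin (t : R) : derivable sin t 1. Proof. exact: derivable_sin. Qed.

Lemma differentiable_comp_real (h : R -> R) (u : E -> R) x :
  derivable h (u x) 1 -> differentiable u x -> differentiable (fun y => h (u y)) x.
Proof.
by move=> /derivable1_diffP dh du; exact: (@differentiable_comp _ _ _ _ u h).
Qed.

Lemma cdifferentiable_cexp F x : cdifferentiable F x ->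
  cdifferentiable (fun y => cexp (F y)) x.
Proof.
move=> [dr di].
have de := differentiable_comp_real (@dexp _) dr.
have dc := differentiable_comp_real (@dcos _) di.
have ds := differentiable_comp_real (@dsin _) di.
by split; [exact: (differentiableM de dc)|exact: (differentiableM de ds)].
Qed.

Lemma cderiv_cexp i F x : cdifferentiable F x ->
  cderiv i (fun y => cexp (F y)) x = cexp (F x) * cderiv i F x.
Proof.
move=> [dr di].
pose u y := complex.Re (F y); pose w y := complex.Im (F y).
have de : derivable (expR \o u) x (e_ i).
  exact: diff_derivable (differentiable_comp_real (@dexp _) dr).
have dc : derivable (cos \o w) x (e_ i).
  exact: diff_derivable (differentiable_comp_real (@dcos _) di).
have ds : derivable (sin \o w) x (e_ i).
  exact: diff_derivable (differentiable_comp_real (@dsin _) di).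
have Ee : 'D_(e_ i) (expR \o u) x = expR (u x) * 'D_(e_ i) u x.
  by rewrite (derive_comp_real _ (@dexp _) dr) derive_val.
have Ec : 'D_(e_ i) (cos \o w) x = - sin (w x) * 'D_(e_ i) w x.
  by rewrite (derive_comp_real _ (@dcos _) di) derive_val.
have Es : 'D_(e_ i) (sin \o w) x = cos (w x) * 'D_(e_ i) w x.
  by rewrite (derive_comp_real _ (@dsin _) di) derive_val.
transitivity (Complex
    (expR (u x) * (- sin (w x) * 'D_(e_ i) w x) + cos (w x) * (expR (u x) * 'D_(e_ i) u x))
    (expR (u x) * (cos (w x) * 'D_(e_ i) w x) + sin (w x) * (expR (u x) * 'D_(e_ i) u x))).
  rewrite -Ee -Ec -Es.
  exact: (congr2 (@Complex R) (deriveM de dc) (deriveM de ds)).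
rewrite /cexp /cderiv /u /w.
move: ('D_(e_ i) _ x) ('D_(e_ i) _ x) (expR _) (sin _) (cos _) => a b c s t.
apply/eqP; rewrite eq_complex /=.
by apply/andP; split; apply/eqP; ring.
Qed.

End cexp_derivative.

Section conformal.
Variables (R : realType) (M : topologicalType) (A : manifold4 R M).
Variables (g : M -> 'M[R[i]]_4) (hg : is_metric A g).
Implicit Types (phi : M -> R[i]) (p q : M) (X Y Z : M -> cvec R)
  (B : M -> 'cV[R[i]]_4).
Notation D := (deriv_along A).

Lemma deriv_along_cexp phi p v : chart_differentiable A phi p ->
  D p v (fun q => cexp (phi q)) = cexp (phi p) * D p v phi.
Proof.
move=> df; rewrite /deriv_along mulr_sumr; apply: eq_bigr => i _.
rewrite mulrCA; congr (_ * _).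
by rewrite -[in cexp (phi p)](chartK (chart_atP A p)); exact: cderiv_cexp.
Qed.

Lemma form_eval_differential B phi q v :
  form_eval (fun p => B p - 2 *: differential A phi p) q v =
  form_eval B q v - 2 * D q v phi.
Proof.
rewrite /form_eval mulmxBr -scalemxAr [LHS]mxE; congr (_ + _).
rewrite mxE [in LHS]mxE mxE; congr (- (_ * _)).
by apply: eq_bigr => i _; rewrite mxE.
Qed.

Lemma pairing_rescale phi q u v :
  pairing (rescale phi g) q u v = cexp (2 * phi q) * pairing g q u v.
Proof. by rewrite /pairing /rescale -scalemxAr -scalemxAl mxE. Qed.

(** Differentiating the factor [cexp (2 * phi)] adds [2 d phi] times the rescaled metric, which the
    shift of [B] absorbs. The connection stays the same, and neither its axioms nor its torsion
    involve the metric. *)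
Lemma weyl_rescale nabla B phi : smooth A phi -> is_weyl A g nabla B ->
  is_weyl A (rescale phi g) nabla (fun p => B p - 2 *: differential A phi p).
Proof.
move=> sphi [lin tors sB metr]; split=> //.
  move=> p X sX; have sD := smooth_deriv_along sX (sphi p).
  apply: eq_smooth_at (smooth_atB (sB p X sX) (smooth_atM (smooth_at_cst A 2 p) sD)).
  by apply: nearW => q; rewrite form_eval_differential.
move=> p v X Y sX sY; have := metr p v X Y sX sY; rewrite /covd_metric.
have sphi2 : smooth_at A (fun q => 2 * phi q) p.
  by apply: smooth_atM (sphi p); exact: smooth_at_cst.
have d2 := smooth_at_differentiable sphi2.
have dE : chart_differentiable A (fun q => cexp (2 * phi q)) p by exact: cdifferentiable_cexp.
have dg : chart_differentiable A (fun q => pairing g q (X q) (Y q)) p.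
  by apply: smooth_at_differentiable; case: hg => _ _; apply.
have ED : D p v (fun q => pairing (rescale phi g) q (X q) (Y q)) =
    cexp (2 * phi p) * (2 * D p v phi) * pairing g p (X p) (Y p)
    + cexp (2 * phi p) * D p v (fun q => pairing g q (X q) (Y q)).
  rewrite (@eq_deriv_along _ _ A p v _
    (fun q => cexp (2 * phi q) * pairing g q (X q) (Y q))); last first.
    by apply: nearW => q; rewrite pairing_rescale.
  rewrite (deriv_along_mulf v dE dg) (deriv_along_cexp v d2).
  have dc := smooth_at_differentiable (smooth_at_cst A 2 p).
  rewrite (deriv_along_mulf v dc (smooth_at_differentiable (sphi p))).
  by rewrite deriv_along_cst mul0r add0r.
subst_atom ED; subst_atom (form_eval_differential B phi p v).
subst_atom (pairing_rescale phi p (nabla X p v) (Y p)).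
subst_atom (pairing_rescale phi p (X p) (nabla Y p v)).
subst_atom (pairing_rescale phi p (X p) (Y p)).
generalize (cexp (2 * phi p)) => e.
move=> /(canRL (subrK _))/(canRL (subrK _)) H; subst_atom H.
by ring_atoms.
Qed.

Lemma connection_restrict (N : M -> {vspace cvec R}) nabla :
  is_linear_connection A nabla -> preserves A N nabla -> is_connection_on A N nabla.
Proof.
have full p X : section_at A N X p -> section_at A (fun=> fullv) X p.
  by move=> [sX _]; split=> //; apply: nearW => q; exact: memvf.
move=> [_ lin add leib smo] pN; split=> [p Y v sY _|p Y c u v /full sY _ _|
  p Y Z v /full sY /full sZ _|p f Y v sf /full sY _|p X Y /full sX /full sY].
- exact: pN.
- by apply: lin => //; exact: memvf.
- by apply: add => //; exact: memvf.
- by apply: leib => //; exact: memvf.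
- exact: smo.
Qed.

End conformal.

Theorem theorem6p1 (R : realType) (M : topologicalType) (A : manifold4 R M)
    (g : M -> 'M[R[i]]_4) (N : M -> {vspace cvec R})
    (hg : is_metric A g) (hN : is_distribution2 A N)
    (hnull : totally_null g N) (hint : integrable A N) :
  exists nablaN : covariant_derivative R M,
    [/\ is_characteristic A g N nablaN,
        forall nablaN' : covariant_derivative R M,
          is_characteristic A g N nablaN' -> eq_on A N nablaN' nablaN &
        forall phi : M -> R[i], smooth A phi ->
          (forall (nablaW : covariant_derivative R M) (B : M -> 'cV[R[i]]_4),
             is_weyl A g nablaW B ->
             is_weyl A (rescale phi g) nablaW
               (fun p => B p - 2 *: differential A phi p)) /\
          is_characteristic A (rescale phi g) N nablaN].
Proof.
have [B sB pB] := glue_oneforms (@preserving_affine _ _ A g N)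
  (preserving_exists hg hN hnull hint).
have wB := weyl_nabla_weyl hg sB.
have pN := preserving_weyl_nabla hg hN hnull pB.
have [lin _ _ _] := wB; have con := connection_restrict lin pN.
exists (weyl_nabla A g B); split.
(* A global Weyl connection can represent its own restriction, since [eq_on] compares only vectors
   and sections of N. *)
- by split=> //; exists (weyl_nabla A g B), B.
- move=> nabla' [_ [nablaW [B' [wB' pN' eqN]]]] p Y v sY vN.
  rewrite (eqN p Y v sY vN).
  exact: (weyl_preserving_unique hg hN hnull wB' pN' wB pN).
- move=> phi sphi; split; first by move=> nablaW B'; exact: weyl_rescale.
  (* The same Weyl connection is a witness for the rescaled metric, with the shifted 1-form;
     preservation of N does not mention the metric. *)
  split=> //; exists (weyl_nabla A g B), (fun p => B p - 2 *: differential A phi p).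
  by split=> //; exact: weyl_rescale.
Qed.
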